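(* Let $\rho:I\rightarrow\mathrm{GL}(V)$ be an irreducible continuous $\overline{\mathbb{Q}}_\ell$-representation of dimension $n$ of $I=\mathrm{Gal}(k(\!(t)\!)^{sep}|k(\!(t)\!))$, and let $P\subset I$ be the wild ramification subgroup. Then there is a continuous character $\chi:I\rightarrow\overline{\mathbb{Q}}_\ell^*$, trivial on $P$, such that $\rho\otimes\chi$ has finite image.
   Context: $k$ is the algebraic closure of a finite field of characteristic $p$ and $\ell\neq p$ is a prime. $P$ is the absolute Galois group of the maximal tamely ramified extension of $k(\!(t)\!)$ (the pro-$p$-Sylow subgroup of $I$). All representations of $I$ are continuous. *)

(* Defs.v *)
From HB Require Import structures.
From mathcomp Require Import all_boot all_order all_algebra all_field.
From mathcomp Require Import all_classical all_reals topology.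

Set Implicit Arguments.
Unset Strict Implicit.
Unset Printing Implicit Defensive.

Import Order.TTheory GRing.Theory Num.Theory.

Local Open Scope classical_set_scope.
Local Open Scope ring_scope.

(* k[[t]]: the series \sum_n a_n t^n is given by its coefficients a. *)
Record fps (k : Type) := Fps { fps_coef : nat -> k }.

HB.instance Definition _ (k : Type) := gen_eqMixin (fps k).
HB.instance Definition _ (k : Type) := gen_choiceMixin (fps k).

Section PowerSeries.
Variable k : fieldType.
Implicit Types f g h : fps k.

Lemma fpsP f g : fps_coef f =1 fps_coef g <-> f = g.
Proof.
split=> [|-> //]; case: f => f; case: g => g /= fg.
by congr Fps; apply/funext.
Qed.

Definition fps_const (c : k) : fps k := Fps (fun n => c *+ (n == 0)%N).
Definition fps_X : fps k := Fps (fun n => (n == 1)%N%:R).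
Definition fps_opp f : fps k := Fps (fun n => - fps_coef f n).
Definition fps_add f g : fps k := Fps (fun n => fps_coef f n + fps_coef g n).
Definition fps_mul f g : fps k :=
  Fps (fun n => \sum_(i < n.+1) fps_coef f i * fps_coef g (n - i)).

Fact fps_addA : associative fps_add.
Proof. by move=> f g h; apply/fpsP => n /=; rewrite addrA. Qed.
Fact fps_addC : commutative fps_add.
Proof. by move=> f g; apply/fpsP => n /=; rewrite addrC. Qed.
Fact fps_add0 : left_id (fps_const 0) fps_add.
Proof. by move=> f; apply/fpsP => n /=; rewrite mul0rn add0r. Qed.
Fact fps_addN : left_inverse (fps_const 0) fps_opp fps_add.
Proof. by move=> f; apply/fpsP => n /=; rewrite mul0rn addNr. Qed.

HB.instance Definition _ :=
  GRing.isZmodule.Build (fps k) fps_addA fps_addC fps_add0 fps_addN.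

Lemma fps_mul_rev f g n :
  fps_coef (fps_mul f g) n
  = \sum_(i < n.+1) fps_coef f (n - i) * fps_coef g i.
Proof.
rewrite /= (reindex_inj rev_ord_inj) /=.
by apply: eq_bigr => j _; rewrite (sub_ordK j).
Qed.

Fact fps_mulC : commutative fps_mul.
Proof.
move=> f g; apply/fpsP => n; rewrite fps_mul_rev /=.
by apply: eq_bigr => i _; rewrite mulrC.
Qed.

Fact fps_mulA : associative fps_mul.
Proof.
move=> f g h; apply/fpsP => i; rewrite [RHS]fps_mul_rev.
rewrite [LHS]/=; under eq_bigr do rewrite -/(fps_coef (fps_mul _ _) _).
pose c j l := fps_coef f j * (fps_coef g (i - j - l) * fps_coef h l).
transitivity (\sum_(j < i.+1) \sum_(l < i.+1 | (l <= i - j)%N) c j l).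
  apply: eq_bigr => /= j _; rewrite -[X in _ * X]/(fps_coef (fps_mul g h) (i - j)).
  rewrite fps_mul_rev big_distrr /=.
  by rewrite (big_ord_narrow_leq (leq_subr _ _)).
rewrite (exchange_big_dep predT) //=; apply: eq_bigr => l _.
transitivity (\sum_(j < i.+1 | (j <= i - l)%N) c j l).
  apply: eq_bigl => j; rewrite -ltnS -(ltnS j) -!subSn ?leq_ord //.
  by rewrite -subn_gt0 -(subn_gt0 j) -!subnDA addnC.
rewrite (big_ord_narrow_leq (leq_subr _ _)) big_distrl /=.
by apply: eq_bigr => j _; rewrite /c -!subnDA addnC mulrA.
Qed.

Fact fps_mul1 : left_id (fps_const 1) fps_mul.
Proof.
move=> f; apply/fpsP => n /=; rewrite big_ord_recl subn0 mul1r.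
by rewrite big1 ?addr0 // => j _; rewrite /= mulr0n mul0r.
Qed.

Fact fps_mulD : left_distributive fps_mul fps_add.
Proof.
move=> f g h; apply/fpsP => n /=; rewrite -big_split /=.
by apply: eq_bigr => j _; rewrite mulrDl.
Qed.

Fact fps_neq0 : fps_const 1 != 0.
Proof.
apply/eqP => /fpsP /(_ 0%N) /= /eqP.
by rewrite mulr1n (_ : (0 : k) *+ _ = 0) ?mul0rn // oner_eq0.
Qed.

HB.instance Definition _ := GRing.Zmodule_isComNzRing.Build (fps k)
  fps_mulA fps_mulC fps_mul1 fps_mulD fps_neq0.

Definition fps_unit : {pred fps k} := [pred f | `[< exists g, g * f = 1 >]].
Definition fps_inv f : fps k :=
  if f \in fps_unit then xget 0 [set g | g * f = 1] else f.

Fact fps_mulV : {in fps_unit, left_inverse 1 fps_inv *%R}.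
Proof.
move=> f uf; rewrite /fps_inv uf.
have [g gf] : exists g, g * f = 1 by move/asboolP: uf.
exact: (@xgetPex _ 0 [set g | g * f = 1] (ex_intro _ g gf)).
Qed.
Fact fps_unitP f g : g * f = 1 -> fps_unit f.
Proof. by move=> gf; apply/asboolP; exists g. Qed.
Fact fps_inv_out : {in [predC fps_unit], fps_inv =1 id}.
Proof. by move=> f; rewrite inE /fps_inv => /negbTE ->. Qed.

HB.instance Definition _ := GRing.ComNzRing_hasMulInverse.Build (fps k)
  fps_mulV fps_unitP fps_inv_out.

Fact fps_lowest f : f != 0 ->
  exists2 m, fps_coef f m != 0 & forall i, (i < m)%N -> fps_coef f i = 0.
Proof.
move=> f0; have ex : exists m, fps_coef f m != 0.
  apply: contrapT => /forallNP all0; case/eqP: f0; apply/fpsP => m /=.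
  by rewrite mul0rn; apply/eqP/negPn/negP/all0.
exists (ex_minn ex) => [|i]; case: ex_minnP => // m _ min_m.
by case: (eqVneq (fps_coef f i) 0) => // /min_m; rewrite leqNgt => /negbTE ->.
Qed.

Fact fps_integral f g : f * g = 0 -> (f == 0) || (g == 0).
Proof.
move=> fg0; apply/norP => -[/fps_lowest[m fm lf] /fps_lowest[n gn lg]].
move/fpsP/(_ (m + n)%N): fg0 => /=; rewrite mul0rn => /eqP; apply/negP.
have mP : (m < (m + n).+1)%N by rewrite ltnS leq_addr.
rewrite (bigD1 (Ordinal mP)) //= big1 ?addr0 => [|i].
  by rewrite addKn mulf_neq0.
rewrite -val_eqE /= neq_ltn => /orP[/lf -> | mi]; first by rewrite mul0r.
by rewrite lg ?mulr0 // ltn_subLR ?ltn_add2r // -ltnS.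
Qed.

HB.instance Definition _ :=
  GRing.ComUnitRing_isIntegral.Build (fps k) fps_integral.

End PowerSeries.

(* k((t)) is the fraction field of k[[t]]. *)
Definition laurent (k : fieldType) := {fraction fps k}.
HB.instance Definition _ (k : fieldType) := GRing.Field.on (laurent k).

Definition is_separable_closure (K L : fieldType) (iota : {rmorphism K -> L}) :=
  (forall x : L,
     exists2 q : {poly K}, separable_poly q & root (map_poly iota q) x)
  /\ (forall q : {poly L},
        separable_poly q -> (1 < size q)%N -> exists x, root q x).

Section GaloisGroup.
Variables (K L : fieldType) (iota : {rmorphism K -> L}).

Record galgrp := Gal {
  gal_fun :> L -> L;
  gal_zmod : zmod_morphism gal_fun;
  gal_monoid : GRing.monoid_morphism gal_fun;
  gal_bij : bijective gal_fun;
  gal_fix : forall a, gal_fun (iota a) = iota a }.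

HB.instance Definition _ (s : galgrp) :=
  GRing.isZmodMorphism.Build L L s (@gal_zmod s).
HB.instance Definition _ (s : galgrp) :=
  GRing.isMonoidMorphism.Build L L s (@gal_monoid s).

HB.instance Definition _ := gen_eqMixin galgrp.
HB.instance Definition _ := gen_choiceMixin galgrp.

Lemma galgrpP (s t : galgrp) : s =1 t <-> s = t.
Proof.
split=> [|-> //]; case: s t => [s s1 s2 s3 s4] [t t1 t2 t3 t4] /= /funext st.
subst t; congr Gal; exact: Prop_irrelevance.
Qed.

Definition gal_one : galgrp := @Gal idfun (rmorphB idfun)
  (rmorphism_monoidP idfun) (Bijective (frefl _) (frefl _)) (fun=> erefl).

Section Mul.
Variables s t : galgrp.

Fact gal_mul_fix a : (s \o t) (iota a) = iota a.
Proof. by rewrite /= !gal_fix. Qed.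
Definition gal_mul : galgrp := @Gal (s \o t) (rmorphB (s \o t))
  (rmorphism_monoidP (s \o t)) (bij_comp (gal_bij s) (gal_bij t)) gal_mul_fix.
End Mul.

Fact gal_inv_ex (s : galgrp) : exists t : galgrp, cancel s t /\ cancel t s.
Proof.
have [t st ts] := gal_bij s.
have tz : zmod_morphism t.
  by move=> x y; apply: (can_inj st); rewrite gal_zmod !ts.
have tm : GRing.monoid_morphism t.
  by split=> [|x y]; apply: (can_inj st); rewrite ts ?(gal_monoid s) ?ts.
have tf a : t (iota a) = iota a by rewrite -{1}(gal_fix s) st.
by exists (Gal tz tm (Bijective ts st) tf).
Qed.
Definition gal_inv (s : galgrp) : galgrp := projT1 (cid (gal_inv_ex s)).

Fact gal_mulA : associative gal_mul.
Proof. by move=> s t u; apply/galgrpP. Qed.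
Fact gal_mul1 : left_id gal_one gal_mul.
Proof. by move=> s; apply/galgrpP. Qed.
Fact gal_mulr1 : right_id gal_one gal_mul.
Proof. by move=> s; apply/galgrpP. Qed.
Fact gal_mulV : left_inverse gal_one gal_inv gal_mul.
Proof.
by move=> s; apply/galgrpP => x /=; rewrite /gal_inv; case: cid => t /= [].
Qed.
Fact gal_mulrV : right_inverse gal_one gal_inv gal_mul.
Proof.
by move=> s; apply/galgrpP => x /=; rewrite /gal_inv; case: cid => t /= [].
Qed.

(* The product is composition: [(s * t)%g x = s (t x)]. *)
HB.instance Definition _ :=
  isGroup.Build galgrp gal_mulA gal_mul1 gal_mulr1 gal_mulV gal_mulrV.

(* Krull topology. The set of all [t] agreeing with [s] on the finite list [r]
   is the coset s Gal(L/K(r)). *)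
Definition krull_open : set_system galgrp := [set U : set galgrp | forall s, U s ->
  exists r : seq L, forall t : galgrp, {in r, t =1 s} -> U t].

Fact krull_openT : krull_open setT.
Proof. by move=> s _; exists [::]. Qed.
Fact krull_openI : setI_closed krull_open.
Proof.
move=> U V oU oV s [/oU[r rU] /oV[r' rV]]; exists (r ++ r') => t ts.
by split; [apply: rU | apply: rV] => x xr; apply: ts;
  rewrite mem_cat xr ?orbT.
Qed.
Fact krull_open_bigU (I : Type) (f : I -> set galgrp) :
  (forall i, krull_open (f i)) -> krull_open (\bigcup_i f i).
Proof.
by move=> of_ s [i _ /of_[r rf]]; exists r => t /rf fit; exists i.
Qed.

HB.instance Definition _ :=
  isOpenTopological.Build galgrp krull_openT krull_openI krull_open_bigU.

End GaloisGroup.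

(* [Ks] is meant to be a separable closure of k((t)), and [p] the
   characteristic of k. *)
Section WildInertia.
Variables (k Ks : fieldType) (iota : {rmorphism laurent k -> Ks}) (p : nat).

Definition embed_series (f : fps k) : Ks := iota (tofrac f).
Definition embed_const (c : k) : Ks := embed_series (fps_const c).

Definition finite_subextension (E : set Ks) : Prop :=
  [/\ divring_closed (mem E), range iota `<=` E &
      exists b : seq Ks, E = [set x | exists c : 'I_(size b) -> laurent k,
        x = \sum_(i < size b) iota (c i) * b`_i]].

Section Ramification.
Variable E : set Ks.

(* The integral closure of k[[t]] in E, i.e. the valuation ring of E. *)
Definition integers : set Ks := [set x | E x /\ integralOver embed_series x].
Definition int_units : set Ks :=
  [set x | [/\ integers x, x != 0 & integers x^-1]].
Definition max_ideal : set Ks := integers `\` int_units.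
Definition uniformizer (w : Ks) : Prop := max_ideal = [set w * x | x in integers].

(* t O_E = m_E ^ e, as t is a uniformizer of k((t)). *)
Definition ramification_index (e : nat) : Prop :=
  exists w u, [/\ uniformizer w, int_units u &
    embed_series (fps_X k) = u * w ^+ e].

(* Every residue class is a root of a separable polynomial over k. *)
Definition residue_separable : Prop := forall x, integers x ->
  exists2 q : {poly k}, separable_poly q & max_ideal (map_poly embed_const q).[x].

Definition tame : Prop :=
  [/\ finite_subextension E, residue_separable &
      exists2 e, ramification_index e & ~~ (p %| e)%N].

End Ramification.

(* The maximal tamely ramified extension, as the union of the finite ones. *)
Definition max_tame : set Ks := [set x | exists2 E, tame E & E x].

Definition wild_inertia : set (galgrp iota) :=
  [set s : galgrp iota | forall x, max_tame x -> s x = x].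

End WildInertia.

Section AbsoluteValues.
Variable R : realType.

Record is_absolute_value (L : fieldType) (a : L -> R) : Prop := {
  abs_ge0 : forall x, 0 <= a x;
  abs_eq0 : forall x, a x = 0 <-> x = 0;
  absM : forall x y, a (x * y) = a x * a y;
  abs_ultra : forall x y, a (x + y) <= Num.max (a x) (a y) }.

Definition padic_abs (l : nat) (q : rat) : R :=
  if q == 0 then 0
  else l%:R ^ ((logn l `|denq q|)%:Z - (logn l `|numq q|)%:Z).

(* [L] is Q_l: the completion of Q for the l-adic absolute value. *)
Record is_padic_field (l : nat) (L : fieldType) (a : L -> R) : Prop := {
  padic_abs_val : is_absolute_value a;
  padic_abs_rat : forall q : rat, a (ratr q) = padic_abs l q;
  padic_dense : forall x (e : R), 0 < e -> exists q : rat, a (x - ratr q) < e;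
  padic_complete : forall u : nat -> L,
    (forall e : R, 0 < e -> exists N, forall m n,
       (N <= m)%N -> (N <= n)%N -> a (u m - u n) < e) ->
    exists x, forall e : R, 0 < e -> exists N, forall n,
      (N <= n)%N -> a (u n - x) < e }.

(* [C] is an algebraic closure of [L], with the extension of the absolute
   value of [L]. *)
Record is_valued_closure (L : fieldType) (a : L -> R) (C : closedFieldType)
    (j : {rmorphism L -> C}) (b : C -> R) : Prop := {
  closure_algebraic : forall x, algebraicOver j x;
  closure_abs : is_absolute_value b;
  closure_abs_ext : forall x, b (j x) = a x }.

(* [C] with the topology of the distance [a (y - x)]. *)
Definition abs_top (C : fieldType) (a : C -> R) : Type := C.
Section AbsTop.
Variables (C : fieldType) (a : C -> R).
HB.instance Definition _ := Choice.copy (abs_top a) C.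

Definition abs_open : set_system (abs_top a) := [set U | forall x, U x ->
  exists2 e : R, 0 < e & forall y, a ((y : C) - (x : C)) < e -> U y].

Fact abs_openT : abs_open setT.
Proof. by move=> x _; exists 1. Qed.
Fact abs_openI : setI_closed abs_open.
Proof.
move=> U V oU oV x [/oU[e e0 eU] /oV[d d0 dV]].
exists (Num.min e d) => [|y]; rewrite lt_min ?e0 // => /andP[ye yd].
by split; [apply: eU | apply: dV].
Qed.
Fact abs_open_bigU (I : Type) (f : I -> set (abs_top a)) :
  (forall i, abs_open (f i)) -> abs_open (\bigcup_i f i).
Proof.
by move=> of_ x [i _ /of_[e e0 ef]]; exists e => // y /ef; exists i.
Qed.

HB.instance Definition _ :=
  isOpenTopological.Build (abs_top a) abs_openT abs_openI abs_open_bigU.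
End AbsTop.

Section Representations.
Variables (G : groupType) (C : fieldType).

Definition is_representation (V : vectType C) (rho : G -> 'End(V)) : Prop :=
  rho 1%g = \1%VF /\ forall s t, rho (s * t)%g = (rho s \o rho t)%VF.

Definition irreducible (V : vectType C) (rho : G -> 'End(V)) : Prop :=
  {:V}%VS <> 0%VS /\ forall U : {vspace V},
    (forall s, (rho s @: U <= U)%VS) -> U = 0%VS \/ U = {:V}%VS.

(* A morphism to the units of [C]: the values are nonzero by these equations. *)
Definition is_character (chi : G -> C) : Prop :=
  chi 1%g = 1 /\ forall s t, chi (s * t)%g = chi s * chi t.

(* V (x) chi, realized on V itself. *)
Definition twist (V : vectType C) (rho : G -> 'End(V)) (chi : G -> C) s :
  'End(V) := chi s *: rho s.

End Representations.

(* Endomorphisms have the product topology on matrix entries in a basis; it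
   does not depend on the basis. *)
Definition continuous_rep (T : topologicalType) (C : fieldType) (a : C -> R)
    (V : vectType C) (rho : T -> 'End(V)) : Prop :=
  continuous (fun s => passmx.mxof (vbasis {:V}) (vbasis {:V}) (rho s)
                       : 'M[abs_top a]_(\dim {:V})).

Definition continuous_char (T : topologicalType) (C : fieldType) (a : C -> R)
    (chi : T -> C) : Prop :=
  continuous (chi : T -> abs_top a).

End AbsoluteValues.

(* Main.v *)
From HB Require Import structures.
Require Import Defs.
From mathcomp Require Import all_boot all_order all_algebra all_field.
From mathcomp Require Import all_classical all_reals topology.
From mathcomp Require Import zify ring.

(** Write I for the Galois group and call P' the subgroup of the elements that fix
    every root of t of order prime to p. Three facts about P' carry the proof.

    - P' contains wild inertia ([wild_inertia_sub_kummer_fixer]): for n prime to p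
      the extension of k((t)) generated by an n-th root of t is totally and tamely
      ramified.
    - I / P' is abelian ([kummer_fixer_commutator]): an automorphism multiplies an
      n-th root of t by a root of unity, which lies in k.
    - P' is pro-p: for s in P' and x in the separable closure, a power
      s ^ (p ^ a) fixes x ([kummer_fixer_pro_p]).

    The last fact is where the arithmetic of k((t)) enters. By Hensel's lemma, in
    the form of [weierstrass_factorization], the integral closure of k[[t]] in the
    separable closure is a valuation ring. Its residue field is k, its value group
    is torsion modulo the powers of t, and every automorphism preserves it. Let
    s in P' multiply y by a constant w. Up to a fractional power of t fixed by s,
    some y ^ (p ^ c) is a unit, and s fixes its residue, so w = 1. Hence s has no
    eigenvalue in k other than 1; as x has a finite orbit, a power of s - 1 kills
    x, and in characteristic p this means that some s ^ (p ^ a) fixes x.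

    Now let rho be an l-adic representation with l different from p, and N an open
    normal subgroup on which rho is close to 1. If s lies in N and in P', the
    powers s ^ (p ^ a) tend to 1, whereas the distance of rho(s) ^ (p ^ a) to 1
    does not change with a, because p is an l-adic unit ([mx_pow_away_from1]). So
    rho is trivial on the intersection of N and P' ([kummer_fixer_rep1]). This
    intersection contains the commutators of N with I; hence rho(N) commutes with
    rho(I) and, by Schur's lemma, N acts by scalars ([fixer_scalar]). The inverse
    of this scalar character extends by 1 to N P', and from there to I, since
    I / P' is abelian and the units of an algebraically closed field form a
    divisible group ([partial_char_extend]). The resulting chi is continuous, being
    so on the open subgroup N, and the twist of rho by chi is trivial on N, which
    has finite index. *)

Set Implicit Arguments.
Unset Strict Implicit.
Unset Printing Implicit Defensive.

Import Order.TTheory GRing.Theory Num.Theory.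
Import passmx.
Local Open Scope classical_set_scope.
Local Open Scope ring_scope.

(** * Valuation rings *)

Section ValuationRing.
Variables (L : fieldType) (O : set L).

Record valuation_ring : Prop := {
  vring1 : O 1;
  vringB : forall x y, O x -> O y -> O (x - y);
  vringM : forall x y, O x -> O y -> O (x * y);
  vring_total : forall x, O x \/ O x^-1 }.

Definition vunit : set L := [set x | [/\ O x, x != 0 & O x^-1]].
Definition vmax : set L := O `\` vunit.

Hypothesis OP : valuation_ring.

Lemma vring0 : O 0.
Proof. by rewrite -(subrr 1); apply: (vringB OP); apply: vring1. Qed.

Lemma vringN x : O x -> O (- x).
Proof. by move=> Ox; rewrite -sub0r; apply: (vringB OP) => //; exact: vring0. Qed.

Lemma vringD x y : O x -> O y -> O (x + y).
Proof. by move=> Ox Oy; rewrite -[y]opprK; apply: (vringB OP) => //; apply: vringN. Qed.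

Lemma vringX x n : O x -> O (x ^+ n).
Proof.
by move=> Ox; elim: n => [|n IHn]; rewrite ?expr0 ?exprS;
  [exact: vring1 | exact: (vringM OP)].
Qed.

Lemma vunit1 : vunit 1.
Proof. by split; rewrite ?oner_neq0 ?invr1 //; exact: vring1. Qed.

Lemma vunitM x y : vunit x -> vunit y -> vunit (x * y).
Proof.
move=> [Ox x0 Ox'] [Oy y0 Oy']; split; first exact: (vringM OP).
  exact: mulf_neq0.
by rewrite invfM; apply: (vringM OP).
Qed.

Lemma vunitV x : vunit x -> vunit x^-1.
Proof. by move=> [Ox x0 Ox']; split; rewrite ?invr_eq0 ?invrK. Qed.

Lemma vunitX x n : vunit x -> vunit (x ^+ n).
Proof.
by move=> Ux; elim: n => [|n IHn]; rewrite ?expr0 ?exprS;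
  [exact: vunit1 | exact: vunitM].
Qed.

Lemma vunit_ring x : vunit x -> O x.
Proof. by case. Qed.

Lemma vmax_ring x : vmax x -> O x.
Proof. by case. Qed.

Lemma vmax0 : vmax 0.
Proof. by split=> [|[_]]; [exact: vring0 | rewrite eqxx]. Qed.

Lemma vunit_or_vmax x : O x -> vunit x \/ vmax x.
Proof. by move=> Ox; have [Ux|nUx] := pselect (vunit x); [left | right]. Qed.

(** Otherwise [y] would be a factor of a unit of [O], hence a unit. *)
Lemma vmaxMl x y : O x -> vmax y -> vmax (x * y).
Proof.
move=> Ox [Oy nUy]; split=> [|[_ xy0 Oxy]]; first exact: (vringM OP).
apply: nUy; move: xy0; rewrite mulf_eq0 => /norP[x0 y0]; split=> //.
rewrite (_ : y^-1 = x * (x * y)^-1); first exact: (vringM OP).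
by rewrite invfM mulrA divff ?mul1r.
Qed.

Lemma vmax_prime x y : O x -> O y -> vmax (x * y) -> vmax x \/ vmax y.
Proof.
move=> Ox Oy [_ nUxy].
have [Ux|] := vunit_or_vmax Ox; last by left.
have [Uy|] := vunit_or_vmax Oy; last by right.
by case: nUxy; apply: vunitM.
Qed.

(** Of two elements of a valuation ring one divides the other, so their sum is
    a multiple of one of them. *)
Lemma vmaxD x y : vmax x -> vmax y -> vmax (x + y).
Proof.
have step u v : u != 0 -> vmax u -> O (v / u) -> vmax (u + v).
  move=> u0 mu Ovu; rewrite (_ : u + v = (1 + v / u) * u).
    by apply: vmaxMl => //; apply: vringD => //; apply: vring1.
  by rewrite mulrDl mul1r divfK.
move=> mx my; have [->|x0] := eqVneq x 0; first by rewrite add0r.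
have [->|y0] := eqVneq y 0; first by rewrite addr0.
have [Oxy|] := vring_total OP (x / y); first by rewrite addrC; apply: step.
by rewrite invf_div; apply: step.
Qed.

Lemma vmax_sum (I : Type) (r : seq I) (P : pred I) (x : I -> L) :
  (forall i, P i -> vmax (x i)) -> vmax (\sum_(i <- r | P i) x i).
Proof. by move=> mx; elim/big_rec: _ => [|i y /mx]; [exact: vmax0 | exact: vmaxD]. Qed.

Lemma vunitDmax u x : vunit u -> vmax x -> vunit (u + x).
Proof.
move=> Uu mx; have Ou := vunit_ring Uu.
have [//|mux] := vunit_or_vmax (vringD Ou (vmax_ring mx)).
have [_] : vmax u; last by [].
rewrite -(addrK x u); apply: vmaxD => //.
by rewrite -mulN1r; apply: vmaxMl => //; apply: vringN; apply: vring1.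
Qed.

(** Divisibility is a total preorder, so a finite family has a largest term. *)
Lemma exists_dominant (I : finType) (x : I -> L) i0 : x i0 != 0 ->
  exists2 i, x i != 0 & forall j, O (x j / x i).
Proof.
move=> x0; suff /(_ (enum I)) [i xi dom] : forall r : seq I,
    exists2 i, x i != 0 & {in r, forall j, O (x j / x i)}.
  by exists i => // j; apply: dom; rewrite mem_enum.
elim=> [|j r [i xi dom]]; first by exists i0.
have [Oji|Oij] := vring_total OP (x j / x i).
  by exists i => // j'; rewrite inE => /orP[/eqP-> //|/dom].
have [xj|xj] := eqVneq (x j) 0.
  exists i => // j'; rewrite inE => /orP[/eqP->|/dom //].
  by rewrite xj mul0r; exact: vring0.
exists j => // j'; rewrite inE => /orP[/eqP->|/dom Oj'].
  by rewrite divff //; exact: vring1.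
rewrite (_ : x j' / x j = (x j' / x i) * (x j / x i)^-1); first exact: (vringM OP).
by rewrite invf_div mulrA divfK.
Qed.

(** Ultrametric principle. A sum that is 0 must have two terms of the largest
    size; if the sizes of the terms are distinct, the largest one is the size of
    the sum. *)
Lemma sum_dominant (I : finType) (x : I -> L) i :
    x i != 0 -> (forall j, O (x j / x i)) ->
  (exists2 j, j != i & vunit (x j / x i)) \/ vunit ((\sum_j x j) / x i).
Proof.
move=> xi dom; have [|alone] := pselect (exists2 j, j != i & vunit (x j / x i)).
  by left.
right; rewrite (bigD1 i) //= mulrDl divff // mulr_suml.
apply: vunitDmax; first exact: vunit1.
apply: vmax_sum => j ji; have [Uj|//] := vunit_or_vmax (dom j).
by case: alone; exists j.
Qed.

End ValuationRing.

(** * Power series *)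

(** Power series are built from this, one coefficient at a time. *)
Lemma course_of_values (A : Type) (step : seq A -> A) :
  exists u : nat -> A, forall n, u n = step (mkseq u n).
Proof.
pose prefix := fix prefix n :=
  if n is m.+1 then rcons (prefix m) (step (prefix m)) else [::].
exists (fun n => step (prefix n)) => n; congr step.
elim: n => //= n IHn; rewrite {1}IHn.
by rewrite /mkseq -[in RHS]addn1 iotaD map_cat cats1.
Qed.

Section PowerSeries.
Variable k : fieldType.
Implicit Types f g : fps k.

Fact fps_const_zmod : zmod_morphism (@fps_const k).
Proof. by move=> a b; apply/fpsP => n /=; rewrite mulrnBl. Qed.
Fact fps_const_monoid : GRing.monoid_morphism (@fps_const k).
Proof.
split=> // a b; apply/fpsP => n /=; rewrite big_ord_recl subn0 mulr1n big1 => [|i _].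
  by rewrite addr0 mulrnAr.
by rewrite mulr0n mul0r.
Qed.
HB.instance Definition _ :=
  GRing.isZmodMorphism.Build k (fps k) (@fps_const k) fps_const_zmod.
HB.instance Definition _ :=
  GRing.isMonoidMorphism.Build k (fps k) (@fps_const k) fps_const_monoid.

Lemma fps_coef0 n : fps_coef (0 : fps k) n = 0.
Proof. exact: mul0rn. Qed.

Lemma fps_coef_sum (I : Type) (r : seq I) (P : pred I) (f : I -> fps k) n :
  fps_coef (\sum_(i <- r | P i) f i) n = \sum_(i <- r | P i) fps_coef (f i) n.
Proof.
by apply: (big_morph (fun f => fps_coef f n)) => //; exact: fps_coef0.
Qed.

Lemma fps_coefM f g n :
  fps_coef (f * g) n = \sum_(i < n.+1) fps_coef f i * fps_coef g (n - i).
Proof. by []. Qed.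

Lemma fps_coefM0 f g : fps_coef (f * g) 0 = fps_coef f 0 * fps_coef g 0.
Proof. by rewrite fps_coefM big_ord1. Qed.

(** The equation [f * g = 1] is solved for the coefficients of [g] in turn. *)
Lemma fps_invertible f : fps_coef f 0 != 0 -> exists g, f * g = 1.
Proof.
move=> f0; pose step (s : seq k) : k :=
  ((size s == 0)%:R - \sum_(i < size s) fps_coef f i.+1 * s`_(size s - i.+1))
    / fps_coef f 0.
have [u uE] := course_of_values step.
exists (Fps u); apply/fpsP => n; rewrite fps_coefM big_ord_recl /= subn0.
rewrite {1}uE /step size_mkseq mulrC divfK //.
under [X in _ - X]eq_bigr => i _ do rewrite nth_mkseq ?rev_ord_proof //.
by rewrite subrK.
Qed.

Lemma fps_Xcoef f n :
  fps_coef (fps_X k * f) n = if n is m.+1 then fps_coef f m else 0.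
Proof.
rewrite fps_coefM big_ord_recl /= mul0r add0r.
case: n => [|n]; first by rewrite big_ord0.
by rewrite big_ord_recl /= mul1r subn1 big1 ?addr0 // => i _; rewrite mul0r.
Qed.

Lemma fps_XnMcoef f n m :
  fps_coef (fps_X k ^+ m * f) n = if (m <= n)%N then fps_coef f (n - m) else 0.
Proof.
elim: m n => [|m IHm] [|n]; rewrite ?expr0 ?mul1r ?subn0 // exprS -mulrA fps_Xcoef //.
Qed.

Lemma fps_X_neq0 : fps_X k != 0.
Proof.
by apply/eqP => /fpsP/(_ 1%N)/eqP; rewrite fps_coef0 /= oner_eq0.
Qed.

Lemma fps_factor f : f != 0 ->
  exists m g, fps_coef g 0 != 0 /\ f = fps_X k ^+ m * g.
Proof.
move=> /fps_lowest[m fm lf]; exists m, (Fps (fun n => fps_coef f (n + m))).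
split; first by rewrite /= add0n.
apply/fpsP => n; rewrite fps_XnMcoef /=; case: leqP => [mn|/lf //].
by rewrite subnK.
Qed.

Lemma fps_divX f : fps_coef f 0 = 0 -> exists g, f = fps_X k * g.
Proof.
by move=> f0; exists (Fps (fun n => fps_coef f n.+1)); apply/fpsP => -[|n];
  rewrite fps_Xcoef.
Qed.

(** This is Hensel lifting of the factorization [f = f * 1] modulo t. With
    f = \sum_n F_n t^n and F_n in k[X], the coefficients of t^n in the two
    factors are the remainder and the quotient by F_0 of what is left of F_n. So
    the first factor keeps the degree of F_0, and the second one is 1 modulo t. *)
Lemma weierstrass_factorization (f : {poly fps k}) i0 :
    fps_coef f`_i0 0 != 0 ->
  exists g h : {poly fps k},
    [/\ f = g * h, fps_coef (lead_coef g) 0 != 0 & fps_coef h`_0 0 != 0].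
Proof.
move=> fi0; pose d := size f.
pose F n : {poly k} := \poly_(i < d) fps_coef f`_i n.
have FE n i : (F n)`_i = fps_coef f`_i n.
  by rewrite coef_poly; case: ltnP => // /(nth_default 0) ->; rewrite fps_coef0.
have F0 : F 0 != 0.
  apply: contraNneq fi0 => /(congr1 (fun q : {poly k} => q`_i0)).
  by rewrite FE coef0 => ->.
(* The pairs hold the coefficients of t^n in the first and the second factor. *)
pose step (s : seq ({poly k} * {poly k})) :=
  if size s is n.+1 then
    let A := F n.+1 -
      \sum_(i < n) (nth 0 s i.+1).1 * (nth 0 s (n - i)).2 in
    (A %% F 0, A %/ F 0)
  else (F 0, 1).
have [u uE] := course_of_values step.
have u0 : u 0%N = (F 0, 1) by rewrite uE.
have uS n : let A := F n.+1 - \sum_(i < n) (u i.+1).1 * (u (n - i)%N).2 in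
    u n.+1 = (A %% F 0, A %/ F 0).
  move=> A; rewrite uE /step size_mkseq /A.
  by congr (_ %% _, _ %/ _); congr (_ - _); apply: eq_bigr => i _;
    rewrite !nth_mkseq ?ltnS ?leq_subr.
have FM n : F n = \sum_(i < n.+1) (u i).1 * (u (n - i)%N).2.
  case: n => [|n]; first by rewrite big_ord1 u0 mulr1.
  rewrite big_ord_recl big_ord_recr /= subnn subn0 u0 mulr1 /=.
  set S := \sum_(i < n) _; have -> : S = \sum_(i < n) (u i.+1).1 * (u (n - i)%N).2.
    by apply: eq_bigr => i _; rewrite /bump /= add1n subSS.
  move: (uS n) => /=; set A := F n.+1 - _ => ->/=.
  rewrite addrCA [F 0 * _]mulrC -divp_eq.
  by rewrite addrC subrK.
have szF n : (size (F n) <= d)%N by exact: size_poly.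
pose e := size (F 0).
have szg n : (size (u n.+1).1 < e)%N by rewrite uS /= ltn_modp.
have e_gt0 : (0 < e)%N by rewrite size_poly_gt0.
have e_le_d : (e <= d)%N := szF 0%N.
have szh n : (size (u n).2 <= (d - e).+1)%N.
  elim/ltn_ind: n => -[|n] IHn; first by rewrite u0 /= size_poly1.
  rewrite uS /= size_divp // -/e.
  have szA : (size (F n.+1 - \sum_(i < n) (u i.+1).1 * (u (n - i)%N).2)%R <= d)%N.
    apply: (leq_trans (size_polyD _ _)); rewrite geq_max szF size_polyN.
    apply: (leq_trans (size_sum _ _ _)); apply/bigmax_leqP => i _.
    apply: (leq_trans (size_polyMleq _ _)).
    have := szg i; have := IHn (n - i)%N; rewrite ltnS leq_subr => /(_ isT).
    by move: (size _) (size _) => a b; lia.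
  by move: szA; move: (size _) => a; lia.
pose g := \poly_(i < e) Fps (fun n => (u n).1`_i).
pose h := \poly_(i < (d - e).+1) Fps (fun n => (u n).2`_i).
have gE i n : fps_coef g`_i n = (u n).1`_i.
  rewrite coef_poly; case: ltnP => // ei; rewrite fps_coef0 nth_default //.
  by case: n => [|n]; [rewrite u0 | apply: leq_trans (ltnW (szg n)) ei].
have hE i n : fps_coef h`_i n = (u n).2`_i.
  rewrite coef_poly; case: ltnP => // ei; rewrite fps_coef0 nth_default //.
  exact: leq_trans (szh n) ei.
have ge : fps_coef g`_e.-1 0 = lead_coef (F 0) by rewrite gE u0.
have sg : size g = e.
  apply/eqP; rewrite eqn_leq size_poly /= -[X in (X <= _)%N]prednK //.
  rewrite ltnNge; apply: contra F0 => /leq_sizeP/(_ _ (leqnn _)) ge0.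
  by rewrite -lead_coef_eq0 -ge ge0 fps_coef0.
exists g, h; split; last by rewrite hE u0 coef1 oner_eq0.
  apply/polyP => i; apply/fpsP => n; rewrite -FE FM coef_sum coefM fps_coef_sum.
  under [RHS]eq_bigr => a _ do rewrite fps_coefM.
  rewrite exchange_big /=; apply: eq_bigr => b _; rewrite coefM.
  by apply: eq_bigr => a _; rewrite gE hE.
by rewrite lead_coefE sg ge lead_coef_eq0.
Qed.

End PowerSeries.

(** * The integral closure of the power series is a valuation ring *)

Lemma fractionP (A : idomainType) (x : {fraction A}) :
  exists a b : A, b != 0 /\ x = tofrac a / tofrac b.
Proof.
elim/quotW: x => r; exists (frac r).1, (frac r).2.
have r2 := denom_ratioP r; split=> //.
apply: (canRL (mulfK _)); first by rewrite tofrac_eq0.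
unlock tofrac; rewrite -[LHS]FracField.pi_mul; apply/eqmodP.
rewrite /= FracField.equivfE /FracField.mulf !numden_Ratio ?mulf_neq0 ?oner_eq0 //.
by rewrite !mulr1 mulrC.
Qed.

Section LaurentSeries.
Variable k : fieldType.

Lemma laurent_factor (x : laurent k) : x != 0 ->
  exists m n g, fps_coef g 0 != 0 /\
    x * tofrac (fps_X k) ^+ n = tofrac (fps_X k) ^+ m * tofrac g.
Proof.
have [a [b [b0 ->]]] := fractionP x.
rewrite mulf_eq0 invr_eq0 !tofrac_eq0 (negbTE b0) orbF => a0.
have [m [g [g0 ->]]] := fps_factor a0; have [n [h [h0 bE]]] := fps_factor b0.
have [h' hh'] := fps_invertible h0.
exists m, n, (g * h'); split.
  rewrite fps_coefM0 mulf_neq0 //; apply/eqP => h'0.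
  by move/fpsP/(_ 0%N)/eqP: hh'; rewrite fps_coefM0 h'0 mulr0 eq_sym oner_eq0.
have tn0 : tofrac (fps_X k) ^+ n != 0 by rewrite expf_neq0 ?tofrac_eq0 ?fps_X_neq0.
have h'E : tofrac h' = (tofrac h)^-1.
  have h0' : tofrac h != 0.
    by apply: contraNneq h0 => /eqP; rewrite tofrac_eq0 => /eqP->.
  by apply: (mulfI h0'); rewrite -rmorphM hh' rmorph1 divff.
rewrite bE !rmorphM /= h'E !rmorphXn -!mulrA; congr (_ * (_ * _)).
by rewrite invfM mulrAC mulVf // mul1r.
Qed.

Lemma power_series_valuation_ring : valuation_ring (range (@tofrac (fps k))).
Proof.
split=> [|_ _ [f _ <-] [g _ <-]|_ _ [f _ <-] [g _ <-]|x].
- by exists 1 => //; exact: rmorph1.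
- by exists (f - g) => //; exact: rmorphB.
- by exists (f * g) => //; exact: rmorphM.
have [->|x0] := eqVneq x 0; first by left; exists 0 => //; exact: rmorph0.
have t0 i : tofrac (fps_X k) ^+ i != 0 by rewrite expf_neq0 ?tofrac_eq0 ?fps_X_neq0.
have [m [n [g [g0 xE]]]] := laurent_factor x0.
have [nm|/ltnW mn] := leqP n m; [left | right].
  exists (fps_X k ^+ (m - n) * g) => //; apply: (mulIf (t0 n)).
  by rewrite xE rmorphM rmorphXn mulrAC -exprD subnK.
have [h gh] := fps_invertible g0; exists (fps_X k ^+ (n - m) * h) => //.
apply: (mulfI x0); rewrite divff // rmorphM rmorphXn; apply: (mulIf (t0 m)).
rewrite /= mul1r -mulrA mulrAC -exprD subnK // mulrA.
by rewrite xE -mulrA -rmorphM gh rmorph1 mulr1.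
Qed.

End LaurentSeries.

(** For [q] of degree [m], the right-hand side is the value at [x] of the reversal
    of [q]. *)
Lemma horner_inv (L : fieldType) (q : {poly L}) m x : (size q <= m.+1)%N -> x != 0 ->
  q.[x^-1] * x ^+ m = \sum_(i < m.+1) q`_i * x ^+ (m - i).
Proof.
move=> qm x0; rewrite (horner_coef_wide _ qm) mulr_suml; apply: eq_bigr => i _.
have im : (i <= m)%N by rewrite -ltnS.
rewrite -mulrA; congr (_ * _).
by rewrite -[X in _ * _ ^+ X](subnK im) exprD mulrCA exprVn mulVf ?mulr1 // expf_neq0.
Qed.

Section IntegralClosure.
Variables (k Ks : fieldType) (iota : {rmorphism laurent k -> Ks}).

Local Notation emb := (embed_series iota).

HB.instance Definition _ := GRing.RMorphism.copy emb (iota \o @tofrac (fps k)).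

Definition integral_closure : set Ks := [set x | integralOver emb x].
Local Notation O := integral_closure.

Lemma embed_eq0 f : (emb f == 0) = (f == 0).
Proof. by rewrite /embed_series fmorph_eq0 tofrac_eq0. Qed.

Lemma integral_root_unit_lead (q : {poly fps k}) x :
  fps_coef (lead_coef q) 0 != 0 -> root (map_poly emb q) x -> O x.
Proof.
move=> /fps_invertible[g qg] qx; exists (q * g%:P).
  by rewrite monicE lead_coefM lead_coefC qg.
by rewrite rmorphM rootM qx.
Qed.

Lemma integral_root_unit_const (q : {poly fps k}) x :
  fps_coef q`_0 0 != 0 -> root (map_poly emb q) x -> O x^-1.
Proof.
move=> q0 qx; have q0' : q`_0 != 0.
  by apply: contraNneq q0 => ->; rewrite fps_coef0.
have x0 : x != 0.
  apply: contraNneq q0' => x0; move: qx.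
  by rewrite x0 /root horner_coef0 coef_map embed_eq0.
have sq : size q = (size q).-1.+1.
  by rewrite prednK // size_poly_gt0; apply: contraNneq q0' => ->; rewrite coef0.
move: (size q).-1 sq => m sq.
pose r := \poly_(i < m.+1) q`_(m - i).
have rm : r`_m = q`_0 by rewrite coef_poly ltnSn subnn.
have sr : size r = m.+1.
  apply/eqP; rewrite eqn_leq size_poly ltnNge.
  by apply/negP => /leq_sizeP/(_ m (leqnn m))/eqP; rewrite rm (negbTE q0').
apply: (@integral_root_unit_lead r); first by rewrite lead_coefE sr rm.
have szm (u : {poly fps k}) : size u = m.+1 -> (size (map_poly emb u) <= m.+1)%N.
  by move=> <-; exact: size_poly.
have E : (map_poly emb q).[x] = (map_poly emb r).[x^-1] * x ^+ m.
  rewrite horner_inv ?szm // (horner_coef_wide _ (szm q sq)).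
  rewrite (reindex_inj rev_ord_inj) /=; apply: eq_bigr => i _.
  by rewrite !coef_map /= coef_poly ltn_ord subSS.
by move: qx; rewrite /root E mulf_eq0 expf_eq0 (negbTE x0) andbF orbF.
Qed.

Hypothesis Ks_alg : forall x, algebraicOver iota x.

(** Dividing an equation of [x] by its largest coefficient makes all coefficients
    power series and one of them 1. By [weierstrass_factorization], [x] is then a
    root of a polynomial with invertible leading coefficient, or of one with
    invertible constant coefficient. *)
Lemma integral_or_inverse x : O x \/ O x^-1.
Proof.
have [q q0 qx] := Ks_alg x.
have qi : q`_(size q).-1 != 0 by rewrite -lead_coefE lead_coef_eq0.
have sq : (0 < size q)%N by rewrite size_poly_gt0.
have lt_q : ((size q).-1 < size q)%N by rewrite prednK.
have [i qi0 dom] := @exists_dominant _ _ (power_series_valuation_ring k) _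
  (fun i : 'I_(size q) => q`_i) (Ordinal lt_q) qi.
have /choice[f fE] : forall j : 'I_(size q), exists f, tofrac f = q`_j / q`_i.
  by move=> j; have [f _ ?] := dom j; exists f.
pose F := \poly_(j < size q)
  (if (insub j : option 'I_(size q)) is Some j' then f j' else 0).
have FE : map_poly (@tofrac _) F = (q`_i)^-1 *: q.
  apply/polyP => j; rewrite coef_map coefZ coef_poly; case: ltnP => [jq|qj].
    by rewrite insubT /= fE /= mulrC.
  by rewrite (nth_default _ qj) mulr0; exact: rmorph0.
have Fi : F`_i = 1.
  apply/eqP; rewrite -tofrac_eq -coef_map FE coefZ mulVf // rmorph1 //.
have [|g [h [FE' g0 h0]]] := @weierstrass_factorization _ F i.
  by rewrite Fi oner_eq0.
have : root (map_poly emb F) x.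
  rewrite /embed_series map_poly_comp FE map_polyZ rootZ // fmorph_eq0.
  by rewrite invr_eq0.
rewrite FE' rmorphM rootM => /orP[gx|hx]; [left | right].
  exact: integral_root_unit_lead gx.
exact: integral_root_unit_const hx.
Qed.

Lemma integral_valuation_ring : valuation_ring O.
Proof.
split; [exact: integral1 | | | exact: integral_or_inverse].
  by move=> x y; exact: integral_sub.
by move=> x y; exact: integral_mul.
Qed.

End IntegralClosure.

(** * Residue field and value group *)

Lemma poly_roots_finite (L : idomainType) (q : {poly L}) : q != 0 ->
  exists rs : seq L, forall x, root q x -> x \in rs.
Proof.
elim: {q}(size q) {-2}q (leqnn (size q)) => [|n IHn] q.
  by rewrite leqn0 size_poly_eq0 => /eqP->; rewrite eqxx.
move=> sq q0; have [[a qa]|noroot] := pselect (exists a, root q a); last first.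
  by exists [::] => x qx; case: noroot; exists x.
have [q' qE] := factor_theorem q a qa.
have q'0 : q' != 0 by apply: contraNneq q0 => q'0; rewrite qE q'0 mul0r.
have [|rs rsP] := IHn q' _ q'0.
  by move: sq; rewrite qE size_Mmonic ?monicXsubC // size_XsubC addn2.
exists (a :: rs) => x; rewrite qE rootM root_XsubC inE orbC.
by case/orP=> [->|/rsP ->]; rewrite ?orbT.
Qed.

(** The polynomial and its derivative generate the nonzero constant n c. *)
Lemma separable_Xn_subC (L : fieldType) n (c : L) : n%:R != 0 :> L -> c != 0 ->
  separable_poly ('X^n - c%:P).
Proof.
case: n => [|n]; first by rewrite mulr0n eqxx.
move=> n0 c0; rewrite unlock derivB derivXn derivC subr0 /=.
apply/Bezout_coprimepP; exists (- n.+1%:R%:P, 'X).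
set u := (X in X %= 1); have -> : u = (n.+1%:R * c)%:P.
  rewrite /u /= polyCM polyC_natr mulrBr !mulNr opprK mulrnAr -exprS !mulr_natl.
  by rewrite addrAC addNr add0r.
by rewrite polyC_eqp1 mulf_neq0.
Qed.

Lemma vunit_root (L : fieldType) (O : set L) (OP : valuation_ring O) x n :
  (0 < n)%N -> vunit O (x ^+ n) -> vunit O x.
Proof.
move=> n0; wlog Ox : x / O x.
  move=> IH Uxn; have [Ox|Ox'] := vring_total OP x; first exact: IH.
  by rewrite -[x]invrK; apply: vunitV; apply: IH; rewrite // exprVn; apply: vunitV.
move=> Uxn; have [//|mx] := vunit_or_vmax Ox; case: n n0 Uxn => // n _ Uxn.
have [_] : vmax O (x ^+ n.+1); last by [].
by rewrite exprSr; apply: vmaxMl => //; apply: vringX.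
Qed.

Section ResidueField.
Variables (k Ks : fieldType) (iota : {rmorphism laurent k -> Ks}).
Hypothesis Ks_alg : forall x, algebraicOver iota x.

Local Notation emb := (embed_series iota).
Local Notation const := (embed_const iota).
Local Notation O := (integral_closure iota).
Local Notation T := (emb (fps_X k)).
Local Notation OP := (integral_valuation_ring Ks_alg).

HB.instance Definition _ := GRing.RMorphism.copy const (emb \o @fps_const k).

Lemma integral_embed f : O (emb f).
Proof. exact: integral_id. Qed.

Lemma integral_const c : O (const c).
Proof. exact: integral_embed. Qed.

Lemma unit_embed f : fps_coef f 0 != 0 -> vunit O (emb f).
Proof.
move=> f0; have [g fg] := fps_invertible f0.
have f0' : emb f != 0.
  by rewrite embed_eq0; apply: contraNneq f0 => ->; rewrite fps_coef0.
split=> //; first exact: integral_embed.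
rewrite (_ : (emb f)^-1 = emb g); first exact: integral_embed.
by apply: (mulfI f0'); rewrite divff // -rmorphM fg rmorph1.
Qed.

Lemma unif_neq0 : T != 0.
Proof. by rewrite embed_eq0 fps_X_neq0. Qed.

(** If 1/t were integral, clearing denominators in its equation would make 1 a
    multiple of t among the power series. *)
Lemma vmax_unif : vmax O T.
Proof.
split=> [|[_ T0 [q /monicP q1 /rootP qT]]]; first exact: integral_embed.
have q0 : q != 0 by rewrite -lead_coef_eq0 q1 oner_neq0.
have sq : size q = (size q).-1.+1 by rewrite prednK // size_poly_gt0.
move: q1; rewrite lead_coefE; move: (size q).-1 sq => m sq qm.
have szm : (size (map_poly emb q) <= m.+1)%N by rewrite -sq; exact: size_poly.
have : emb (\sum_(i < m.+1) q`_i * fps_X k ^+ (m - i)) = 0.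
  rewrite -[RHS](mul0r (T ^+ m)) -qT (horner_inv szm T0) rmorph_sum.
  by apply: eq_bigr => i _; rewrite coef_map rmorphM rmorphXn.
have coefX0 e : fps_coef (fps_X k ^+ e) 0 = (e == 0)%N%:R.
  case: e => [|e]; first by rewrite expr0 /= mulr1n.
  by rewrite exprS fps_coefM0 /= mul0r.
move/eqP; rewrite embed_eq0 => /eqP/fpsP/(_ 0%N)/eqP.
rewrite fps_coef_sum fps_coef0; under eq_bigr => i _ do rewrite fps_coefM0 coefX0.
rewrite big_ord_recr /= subnn eqxx mulr1 qm /= mulr1n big1 ?add0r ?oner_eq0 //.
by move=> i _; rewrite subn_eq0 leqNgt ltn_ord mulr0.
Qed.

Lemma vmax_embed f : fps_coef f 0 = 0 -> vmax O (emb f).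
Proof.
move=> /fps_divX[g ->]; rewrite rmorphM /= mulrC.
by apply: (vmaxMl OP); [exact: integral_embed | exact: vmax_unif].
Qed.

Lemma vmax_const c : vmax O (const c) -> c = 0.
Proof.
move=> [_ nU]; apply/eqP; apply: contra_notT nU => c0; apply: unit_embed.
by rewrite /= mulr1n.
Qed.

(** In an algebraic equation of [y] over k((t)) two terms have the same size;
    their quotient is a power of [y] times a Laurent series, which is itself a
    unit times a power of t. *)
Lemma value_torsion y : y != 0 ->
  exists N a b, (0 < N)%N /\ vunit O (y ^+ N * T ^+ a / T ^+ b).
Proof.
move=> y0; have [q q0 qy] := Ks_alg y.
have qi : q`_(size q).-1 != 0 by rewrite -lead_coefE lead_coef_eq0.
have lt_q : ((size q).-1 < size q)%N by rewrite prednK // size_poly_gt0.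
pose x (i : 'I_(size q)) := iota (q : seq (laurent k))`_i * y ^+ i.
have xi0 : x (Ordinal lt_q) != 0 by rewrite mulf_neq0 ?expf_neq0 ?fmorph_eq0.
have [i xi dom] := exists_dominant OP xi0.
have [[j ji Uj]|] := sum_dominant OP xi dom; last first.
  rewrite (_ : \sum_j x j = (map_poly iota q).[y]); last first.
    rewrite horner_coef size_map_poly; apply: eq_bigr => j _.
    by rewrite coef_map.
  by move/rootP: qy => ->; rewrite mul0r => -[_]; rewrite eqxx.
have xj : x j != 0 by case: Uj => _; rewrite mulf_eq0 => /norP[].
have {Uj dom ji xi xj} : exists i j : 'I_(size q),
    [/\ (i < j)%N, x i != 0, x j != 0 & vunit O (x j / x i)].
  move: ji; rewrite neq_ltn => /orP[ji|ij]; last by exists i, j.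
  by exists j, i; split=> //; rewrite -invf_div; apply: vunitV.
case=> {}i [{}j [ij xi xj Uji]].
have qi0 : (q : seq (laurent k))`_i != 0.
  by apply: contraNneq xi => qi0; rewrite /x qi0 rmorph0 mul0r.
have qj0 : (q : seq (laurent k))`_j != 0.
  by apply: contraNneq xj => qj0; rewrite /x qj0 rmorph0 mul0r.
have z0 : (q : seq (laurent k))`_j / (q : seq (laurent k))`_i != 0.
  by rewrite mulf_neq0 // invr_eq0.
have [m [n [g [g0 zE]]]] := laurent_factor z0.
exists (j - i)%N, m, n; rewrite subn_gt0; split=> //.
have T0 e : T ^+ e != 0 by rewrite expf_neq0 ?unif_neq0.
have zE' : iota (q : seq (laurent k))`_j / iota (q : seq (laurent k))`_i * T ^+ n
    = T ^+ m * emb g.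
  by move/(congr1 iota): zE; rewrite !rmorphM !rmorphXn /= fmorphV.
have qi0' : iota (q : seq (laurent k))`_i != 0 by rewrite fmorph_eq0.
have [_ g0' _] := unit_embed g0.
have -> : y ^+ (j - i) * T ^+ m / T ^+ n = x j / x i * (emb g)^-1.
  have Tm : T ^+ m = iota (q : seq (laurent k))`_j
      / iota (q : seq (laurent k))`_i * T ^+ n / emb g.
    by rewrite zE' mulfK.
  have yj : y ^+ j = y ^+ (j - i) * y ^+ i by rewrite -exprD subnK // ltnW.
  rewrite Tm /x yj.
  have := T0 n; have := expf_neq0 i y0.
  move: (T ^+ n) (y ^+ i) (y ^+ (j - i)) (emb g) (iota _) (iota _) g0' qi0'.
  by move=> tn yi yij g' a b g'0 b0 yi0 tn0; field; rewrite g'0 b0 yi0 tn0.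
by apply: (vunitM OP) => //; apply: vunitV; apply: unit_embed.
Qed.

End ResidueField.

(** * Elements fixing the roots of t have pro-p order *)

Lemma expBn_pchar (A : comNzRingType) p c (x y : A) : p \in [pchar A] ->
  (x - y) ^+ (p ^ c) = x ^+ (p ^ c) - y ^+ (p ^ c).
Proof.
move=> pA; have pc : (GRing.pchar A).-nat (p ^ c)%N.
  by rewrite pnatX pnatE ?(pcharf_prime pA) // pA.
by rewrite exprDn_pchar // exprNn_pchar.
Qed.

Section GaloisAction.
Variables (k Ks : fieldType) (iota : {rmorphism laurent k -> Ks}).
Hypothesis Ks_alg : forall x, algebraicOver iota x.

Local Notation emb := (embed_series iota).
Local Notation const := (embed_const iota).
Local Notation O := (integral_closure iota).
Implicit Types (s : galgrp iota) (q r : {poly k}) (x : Ks).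

Lemma gal_embed s f : s (emb f) = emb f.
Proof. exact: gal_fix. Qed.

Lemma gal_integral s x : O x -> O (s x).
Proof.
case=> q q1 qx; exists q => //.
have -> : map_poly emb q = map_poly s (map_poly emb q).
  by rewrite -map_poly_comp; apply: eq_map_poly => f; rewrite /= gal_embed.
exact: rmorph_root.
Qed.

Lemma gal_vmax s x : vmax O x -> vmax O (s x).
Proof.
move=> [Ox nUx]; split; first exact: gal_integral.
have sK : cancel s (s^-1)%g by move=> z; rewrite -[LHS]/((s^-1 * s)%g z) mulVg.
move=> [_ sx0 Osx]; apply: nUx; split=> //.
  by apply: contraNneq sx0 => ->; rewrite rmorph0.
by rewrite -(sK x^-1) fmorphV; apply: gal_integral.
Qed.

Lemma gal_expg s n x : (s ^+ n)%g x = iter n s x.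
Proof. by elim: n => // n IHn; rewrite expgS /= -IHn. Qed.

Lemma gal_root s (q : {poly laurent k}) x :
  root (map_poly iota q) x -> root (map_poly iota q) (s x).
Proof.
move=> qx; have -> : map_poly iota q = map_poly s (map_poly iota q).
  by rewrite -map_poly_comp; apply: eq_map_poly => f; rewrite /= gal_fix.
exact: rmorph_root.
Qed.

Definition galois_stable (r : seq Ks) := forall s x, x \in r -> s x \in r.

(** It is enough to add to [r] the roots of an equation of each of its elements. *)
Lemma exists_stable (r : seq Ks) :
  exists2 r', {subset r <= r'} & galois_stable r'.
Proof.
elim: r => [|x r [r' rr' st]]; first by exists [::].
have [q q0 qx] := Ks_alg x.
have [rs rsP] : exists rs : seq Ks, forall y, root (map_poly iota q) y -> y \in rs.
  by apply: poly_roots_finite; rewrite map_poly_eq0.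
exists ([seq y <- rs | root (map_poly iota q) y] ++ r') => [y|s y].
  rewrite inE mem_cat mem_filter => /orP[/eqP->|/rr' ->]; last by rewrite orbT.
  by rewrite qx rsP.
rewrite !mem_cat !mem_filter => /orP[/andP[qy _]|/st ->]; last by rewrite orbT.
have qsy := gal_root s qy.
by rewrite qsy rsP.
Qed.

Lemma gal_orbit s x : exists i j, (i < j)%N /\ iter i s x = iter j s x.
Proof.
have [rs x_rs st] := exists_stable [:: x].
have iter_rs i : iter i s x \in rs.
  by elim: i => [|i IHi]; [apply: x_rs; rewrite inE | apply: st].
apply: contrapT => inj.
have u : uniq (mkseq (fun i => iter i s x) (size rs).+1).
  rewrite map_inj_in_uniq ?iota_uniq // => i j _ _ ij; apply/eqP.
  by case: ltngtP => // lt_ij; case: inj; [exists i, j | exists j, i].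
have sub : {subset mkseq (fun i => iter i s x) (size rs).+1 <= rs}.
  by move=> _ /mapP[i _ ->].
by have := uniq_leq_size u sub; rewrite size_mkseq ltnn.
Qed.

(** The value of [q] at [s], in the algebra of k-linear maps of [Ks]. *)
Definition poly_act s (q : {poly k}) (x : Ks) : Ks :=
  \sum_(i < size q) const q`_i * iter i s x.

Lemma poly_act_wide s n q x : (size q <= n)%N ->
  poly_act s q x = \sum_(i < n) const q`_i * iter i s x.
Proof.
move=> qn; rewrite /poly_act (big_ord_widen n (fun i => const q`_i * iter i s x)) //.
rewrite big_mkcond; apply: eq_bigr => i _; case: ltnP => // qi.
by rewrite nth_default // rmorph0 mul0r.
Qed.

Lemma poly_actB s q r x : poly_act s (q - r) x = poly_act s q x - poly_act s r x.
Proof.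
rewrite !(@poly_act_wide s (maxn (size q) (size r))) ?leq_maxl ?leq_maxr //.
  rewrite -sumrB; apply: eq_bigr => i _.
  by rewrite coefB rmorphB mulrBl.
by rewrite -(size_polyN r) size_polyD.
Qed.

Lemma poly_actZ s c q x : poly_act s (c *: q) x = const c * poly_act s q x.
Proof.
rewrite (poly_act_wide s x (size_scale_leq c q)) /poly_act mulr_sumr.
by apply: eq_bigr => i _; rewrite coefZ rmorphM mulrA.
Qed.

Lemma poly_actX s q x : poly_act s ('X * q) x = s (poly_act s q x).
Proof.
rewrite (@poly_act_wide s (size q).+1); last first.
  by apply: (leq_trans (size_polyMleq _ _)); rewrite size_polyX.
rewrite big_ord_recl coefXM rmorph0 mul0r add0r rmorph_sum.
apply: eq_bigr => i _; rewrite coefXM [RHS]rmorphM; congr (_ * _).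
exact/esym/gal_embed.
Qed.

Lemma poly_act_Xn s n x : poly_act s 'X^n x = iter n s x.
Proof.
elim: n => [|n IHn]; last by rewrite exprS poly_actX IHn.
by rewrite expr0 /poly_act size_poly1 big_ord1 coef1 rmorph1 mul1r.
Qed.

Lemma poly_act_XsubC s c q x :
  poly_act s (('X - c%:P) * q) x = s (poly_act s q x) - const c * poly_act s q x.
Proof. by rewrite mulrBl poly_actB poly_actX mul_polyC poly_actZ. Qed.

End GaloisAction.

(** The roots of t of order prime to [p] generate the maximal tamely ramified
    extension, so this is wild inertia, seen through explicit generators. *)
Definition kummer_fixer (k Ks : fieldType) (iota : {rmorphism laurent k -> Ks})
    (p : nat) : set (galgrp iota) :=
  [set s : galgrp iota | forall n x,
     ~~ (p %| n)%N -> x ^+ n = embed_series iota (fps_X k) -> s x = x].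

Section WildAction.
Variables (k : closedFieldType) (Ks : fieldType).
Variables (iota : {rmorphism laurent k -> Ks}) (p : nat).
Hypothesis Ks_sep : is_separable_closure iota.
Hypothesis char_k : p \in [pchar k].

Local Notation emb := (embed_series iota).
Local Notation const := (embed_const iota).
Local Notation O := (integral_closure iota).
Local Notation T := (emb (fps_X k)).

Lemma separable_closure_algebraic x : algebraicOver iota x.
Proof.
have [q sq qx] := Ks_sep.1 x; exists q => //.
exact: separable_poly_neq0.
Qed.
Local Notation Ks_alg := separable_closure_algebraic.
Local Notation OP := (integral_valuation_ring Ks_alg).

Lemma char_Ks : p \in [pchar Ks].
Proof. by move: char_k; rewrite -(fmorph_pchar const). Qed.

(** The polynomial X^n - t is separable for n prime to p. *)
Lemma kummer_root n : ~~ (p %| n)%N -> exists x, x ^+ n = T.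
Proof.
move=> pn; have n0 : n%:R != 0 :> Ks by rewrite -(dvdn_pcharf char_Ks).
have [|x] := Ks_sep.2 _ (separable_Xn_subC n0 (unif_neq0 iota)).
  rewrite size_XnsubC; first by case: n pn n0; rewrite ?dvdn0.
  by case: n pn n0; rewrite ?dvdn0.
by rewrite /root !hornerE subr_eq0 => /eqP xn; exists x.
Qed.

(** The residue field is k: modulo the maximal ideal, an integral equation
    becomes a product of linear factors over k. *)
Lemma residue_exists z : O z -> exists c, vmax O (z - const c).
Proof.
move=> Oz; have [q q1 /rootP qz] := Oz.
pose qb : {poly k} := \poly_(i < size q) fps_coef q`_i 0.
have qb0 : qb != 0.
  have/monicP qlc := q1; apply/eqP => /polyP/(_ (size q).-1).
  rewrite coef_poly prednK ?size_poly_gt0 ?monic_neq0 // leqnn coef0.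
  by rewrite -lead_coefE qlc /= => /eqP; rewrite mulr1n oner_eq0.
have mqb : vmax O (map_poly const qb).[z].
  rewrite -[X in vmax O X]subr0 -qz -opprB -mulN1r.
  apply: (vmaxMl OP); first by apply: (vringN OP); exact: (vring1 OP).
  rewrite (horner_coef_wide _ (size_poly _ _)).
  rewrite (@horner_coef_wide _ (size q)); last first.
    by rewrite size_map_poly size_poly.
  rewrite -sumrB; apply: (vmax_sum OP) => i _; rewrite -mulrBl mulrC.
  apply: (vmaxMl OP); first exact: (vringX OP).
  rewrite !coef_map coef_poly ltn_ord -rmorphB /=; apply: (vmax_embed Ks_alg).
  by rewrite /= mulr1n subrr.
have [rs qbE] := closed_field_poly_normal qb.
have qbz : (map_poly const qb).[z] =
    const (lead_coef qb) * \prod_(w <- rs) (z - const w).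
  rewrite [in LHS]qbE map_polyZ hornerZ rmorph_prod horner_prod; congr (_ * _).
  by apply: eq_bigr => w _; rewrite rmorphB /= map_polyX map_polyC !hornerE.
move: mqb; rewrite qbz => /(vmax_prime OP (integral_const iota _)) [].
- elim: (rs) => [|w r IHr]; rewrite ?big_nil ?big_cons.
    exact: (vring1 OP).
  apply: (vringM OP); last exact: IHr.
  by apply: (vringB OP) => //; exact: integral_const.
- by move=> /(@vmax_const _ _ iota _) /eqP; rewrite lead_coef_eq0 (negbTE qb0).
elim: rs {qbE qbz} => [|w r IHr]; rewrite ?big_nil ?big_cons.
  by move=> [_ []]; exact: (vunit1 OP).
move=> /(vmax_prime OP) []; last exact: IHr.
- by apply: (vringB OP) => //; exact: integral_const.
- elim: (r) => [|w' r' IHr']; rewrite ?big_nil ?big_cons; first exact: (vring1 OP).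
  by apply: (vringM OP) => //; apply: (vringB OP) => //; exact: integral_const.
- by exists w.
Qed.

(** If [s y = w * y], a power of [y] of exponent p ^ c differs from a fractional
    power of t fixed by [s] by a unit [z]. As [s] acts trivially on the residue
    field, its eigenvalue w ^ (p ^ c) on [z] is 1. *)
Lemma kummer_fixer_eigenvalue (s : galgrp iota) w y :
  kummer_fixer p s -> y != 0 -> s y = const w * y -> w = 1.
Proof.
move=> sK y0 sy; have pr_p := pcharf_prime char_k.
have [N [a [b [N0 UN]]]] := value_torsion Ks_alg y0.
have [d] := pfactor_coprime pr_p N0; rewrite prime_coprime // => pd NE.
move: (logn p N) NE => c NE.
have [r rd] := kummer_root pd.
have r0 : r != 0.
  have := unif_neq0 iota; rewrite -rd; apply: contraNneq => ->.
  by rewrite expr0n; case: (d) pd; rewrite ?dvdn0.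
have d0 : (0 < d)%N by case: (d) pd; rewrite ?dvdn0.
(* The power of [z] of exponent d is the unit y ^ N t ^ a / t ^ b. *)
pose z := y ^+ (p ^ c) * r ^+ a / r ^+ b.
have Uz : vunit O z.
  apply: (vunit_root OP d0); rewrite /z !exprMn exprVn -!exprM.
  by rewrite ![(_ * d)%N]mulnC !exprM rd -exprM -NE.
have sz : s z = const (w ^+ (p ^ c)) * z.
  rewrite /z !rmorphM fmorphV !rmorphXn /= sy (sK _ _ pd rd) exprMn.
  by rewrite !mulrA.
have [u mu] := residue_exists (vunit_ring Uz).
have u0 : u != 0.
  apply/eqP => u0; move: mu; rewrite u0 rmorph0 subr0.
  by case.
have : vmax O (const (u * (1 - w ^+ (p ^ c)))).
  have := gal_vmax s mu; rewrite rmorphB /= sz gal_embed.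
  move: (w ^+ _) => v msz.
  have -> : const (u * (1 - v)) = const v * (z - const u) - (const v * z - const u).
    by rewrite rmorphM rmorphB rmorph1 /=; ring.
  apply: (vmaxD OP).
    by apply: (vmaxMl OP) => //; exact: integral_const.
  by rewrite -mulN1r; apply: (vmaxMl OP) => //; apply: (vringN OP); exact: (vring1 OP).
move/(@vmax_const _ _ iota _)/eqP; rewrite mulf_eq0 (negbTE u0) subr_eq0 => /= /eqP wc.
have /eqP := expBn_pchar c w 1 char_k; rewrite expr1n -wc subrr expf_eq0 subr_eq0.
by case/andP=> _ /eqP.
Qed.

(** Since [s - w] is injective for w <> 1, an annihilator of [s] at [x] can be
    stripped of its roots other than 1; a power of [s - 1] remains, and
    (s - 1) ^ (p ^ a) = s ^ (p ^ a) - 1. *)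
Lemma kummer_fixer_pro_p (s : galgrp iota) x :
  kummer_fixer p s -> exists a, iter (p ^ a) s x = x.
Proof.
move=> sK; have [i [j [ij xij]]] := gal_orbit Ks_alg s x.
pose q : {poly k} := 'X^j - 'X^i.
have q0 : q != 0.
  by rewrite -size_poly_eq0 size_polyDl ?size_polyN ?size_polyXn.
have qx : poly_act s q x = 0 by rewrite poly_actB !poly_act_Xn xij subrr.
have [rs qE] := closed_field_poly_normal q.
have {qE} : exists M,
    poly_act s ((\prod_(w <- rs) ('X - w%:P)) * ('X - 1%:P) ^+ M) x = 0.
  exists 0%N; rewrite mulr1; move: qx; rewrite qE poly_actZ => /eqP.
  rewrite mulf_eq0 => /orP[|/eqP //].
  by rewrite fmorph_eq0 lead_coef_eq0 (negbTE q0).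
case; elim: rs => [|w rs IHrs] M; rewrite ?big_nil ?big_cons ?mul1r; last first.
  have [->|w1] := eqVneq w 1.
    by rewrite mulrAC -exprS mulrC => /IHrs.
  rewrite -mulrA poly_act_XsubC => /eqP; rewrite subr_eq0 => /eqP sw.
  apply: (IHrs M); apply: contraNeq w1 => y0; apply/eqP.
  exact: kummer_fixer_eigenvalue sK y0 sw.
move=> sM; exists M; have pr_p := pcharf_prime char_k.
have Mp : (M <= p ^ M)%N by rewrite ltnW // ltn_expl // prime_gt1.
have : poly_act s (('X - 1%:P) ^+ (p ^ M)) x = 0.
  rewrite -(subnK Mp) addnC; elim: (p ^ M - M)%N => [|e IHe]; first by rewrite addn0.
  by rewrite addnS exprS poly_act_XsubC IHe rmorph0 mulr0 subr0.
rewrite expBn_pchar ?pchar_poly // -polyC_exp expr1n.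
by rewrite polyC1 -(expr0 'X) poly_actB !poly_act_Xn => /eqP; rewrite subr_eq0 => /eqP.
Qed.

End WildAction.

(** * Kummer extensions are tame *)

(** An equation of [y] with nonzero constant term c reads c + r(y) y = 0. *)
Lemma algebraic_inv_poly (K L : fieldType) (f : {rmorphism K -> L}) y :
  algebraicOver f y -> y != 0 -> exists r : {poly K}, y^-1 = (map_poly f r).[y].
Proof.
case=> q q0 qy y0; have [m [q' q'0 qE]] := multiplicity_XsubC q 0.
move: q'0 qy; rewrite q0 /= qE rmorphM rmorphXn rmorphB /= map_polyX map_polyC /=.
rewrite rmorph0 subr0 => q'0; rewrite rootM => /orP[q'y|]; last first.
  by rewrite /root hornerXn expf_eq0 (negbTE y0) andbF.
have [r rE] : exists r, q' - (q'.[0])%:P = r * ('X - 0%:P).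
  by apply: factor_theorem; rewrite /root !hornerE subrr.
exists (- (q'.[0])^-1 *: r).
move: q'y; rewrite -[q'](subrK (q'.[0])%:P) rE subr0 rmorphD rmorphM /=.
rewrite map_polyX map_polyC map_polyZ /root !hornerE /= => /eqP/(canRL (addrK _)).
rewrite sub0r rmorphN fmorphV => ry.
apply: (mulIf y0); rewrite -mulrA ry mulrNN mulVf ?mulVf // fmorph_eq0.
exact: q'0.
Qed.

Section KummerExtension.
Variables (k : closedFieldType) (Ks : fieldType).
Variables (iota : {rmorphism laurent k -> Ks}) (p : nat).
Hypothesis Ks_sep : is_separable_closure iota.

Local Notation emb := (embed_series iota).
Local Notation const := (embed_const iota).
Local Notation O := (integral_closure iota).
Local Notation T := (emb (fps_X k)).
Local Notation Ks_alg := (separable_closure_algebraic Ks_sep).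
Local Notation OP := (integral_valuation_ring Ks_alg).

Variables (x : Ks) (n : nat).
Hypothesis n_gt0 : (0 < n)%N.
Hypothesis xn : x ^+ n = T.

Definition kummer_field : set Ks :=
  [set y | exists q : {poly laurent k}, y = (map_poly iota q).[x]].
Local Notation E := kummer_field.

Lemma kummer_gen_neq0 : x != 0.
Proof.
have := unif_neq0 iota; rewrite -xn; apply: contraNneq => ->.
by rewrite expr0n gtn_eqF.
Qed.

Lemma vmax_kummer_gen : vmax O x.
Proof.
have nUx : ~ vunit O x.
  move=> Ux; have [_] := vmax_unif iota.
  by rewrite -xn; apply; apply: (vunitX OP).
split=> //; have [//|Ox'] := vring_total OP x.
have [OT []] := vmax_unif iota; split=> //; first exact: unif_neq0.
by rewrite -xn -exprVn; apply: (vringX OP).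
Qed.

Lemma kummer_gen_exp_unit a b : vunit O (x ^+ a / x ^+ b) -> a = b.
Proof.
have nU e : (0 < e)%N -> ~ vunit O (x ^+ e).
  by move=> e0 /(vunit_root OP e0); case: vmax_kummer_gen.
have xe e : x ^+ e != 0 by rewrite expf_neq0 ?kummer_gen_neq0.
have E c d : (c < d)%N -> x ^+ d / x ^+ c = x ^+ (d - c).
  by move=> cd; rewrite -{1}(subnK (ltnW cd)) exprD mulfK.
case: (ltngtP a b) => // ab U; last by case: (nU (a - b)%N); rewrite ?subn_gt0 // -E.
by case: (nU (b - a)%N); rewrite ?subn_gt0 // -E // -invf_div; apply: vunitV.
Qed.

Lemma kummer_field_base c : E (iota c).
Proof. by exists c%:P; rewrite map_polyC hornerC. Qed.

Lemma kummer_field_gen : E x.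
Proof. by exists 'X; rewrite map_polyX hornerX. Qed.

Lemma kummer_fieldB y z : E y -> E z -> E (y - z).
Proof. by move=> [q ->] [r ->]; exists (q - r); rewrite rmorphB hornerD hornerN. Qed.

Lemma kummer_fieldM y z : E y -> E z -> E (y * z).
Proof. by move=> [q ->] [r ->]; exists (q * r); rewrite rmorphM hornerM. Qed.

Lemma kummer_fieldV y : E y -> E y^-1.
Proof.
move=> [q yE]; have [->|y0] := eqVneq y 0.
  by rewrite invr0 -(rmorph0 iota); apply: kummer_field_base.
have [r ->] := algebraic_inv_poly (Ks_alg y) y0.
by exists (r \Po q); rewrite map_comp_poly horner_comp -yE.
Qed.

Lemma kummer_field_span y : E y ->
  exists c : nat -> laurent k, y = \sum_(i < n) iota (c i) * x ^+ i.
Proof.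
move=> [q ->]; pose D : {poly laurent k} := 'X^n - (tofrac (fps_X k))%:P.
have sD : size D = n.+1 by rewrite size_XnsubC.
have D0 : D != 0 by rewrite -size_poly_eq0 sD.
have Dx : (map_poly iota D).[x] = 0.
  by rewrite rmorphB /= map_polyXn map_polyC !hornerE xn subrr.
exists (fun i => (q %% D)`_i); rewrite {1}(divp_eq q D) rmorphD rmorphM /=.
rewrite hornerD hornerM Dx mulr0 add0r (@horner_coef_wide _ n).
  by apply: eq_bigr => i _; rewrite coef_map.
by rewrite size_map_poly -ltnS -sD ltn_modp.
Qed.

(** The terms of an expansion in powers of [x] have distinct values modulo n, so
    the largest one determines the value of the sum. *)
Lemma kummer_field_value y : E y -> y != 0 ->
  exists a b, vunit O (y * x ^+ a / x ^+ b).
Proof.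
move=> /kummer_field_span[c yE] y0; pose z (i : 'I_n) := iota (c i) * x ^+ i.
have xe e : x ^+ e != 0 by rewrite expf_neq0 ?kummer_gen_neq0.
have zval i : z i != 0 -> exists a b,
    vunit O (z i * x ^+ (n * a) / x ^+ (n * b + i)).
  move=> zi; have ci : c i != 0.
    by apply: contraNneq zi => ci; rewrite /z ci rmorph0 mul0r.
  have [b [a [g [g0 cE]]]] := laurent_factor ci.
  exists a, b; rewrite (_ : _ / _ = emb g); first exact: unit_embed.
  apply: (canLR (mulfK (xe _))); rewrite exprD !exprM xn /z.
  have : iota (c i) * T ^+ a = T ^+ b * emb g.
    by move/(congr1 iota): cE; rewrite !rmorphM !rmorphXn.
  by rewrite mulrAC => ->; rewrite mulrA (mulrC (emb g)).
have [i0 zi0] : exists i, z i != 0.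
  apply: contrapT => z0; case/eqP: y0; rewrite yE big1 // => i _.
  by apply/eqP/negPn/negP => zi; apply: z0; exists i.
have [i zi dom] := exists_dominant OP zi0; have [a [b Ui]] := zval i zi.
have [[j ji Uj]|U] := sum_dominant OP zi dom; last first.
  exists (n * a)%N, (n * b + i)%N.
  rewrite (_ : _ / _ = (\sum_j z j) / z i * (z i * x ^+ (n * a) / x ^+ (n * b + i))).
    exact: (vunitM OP).
  by rewrite -yE [RHS]mulrA [X in _ = X / _]mulrA divfK.
have zj : z j != 0 by case: Uj => _; rewrite mulf_eq0 => /norP[].
have [a' [b' Uj']] := zval j zj.
have : vunit O (x ^+ (n * b' + j + n * a) / x ^+ (n * b + i + n * a')).
  rewrite (_ : _ / _ = (z j / z i) * (z j * x ^+ (n * a') / x ^+ (n * b' + j))^-1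
    * (z i * x ^+ (n * a) / x ^+ (n * b + i))).
    by apply: (vunitM OP) => //; apply: (vunitM OP) => //; apply: vunitV.
  rewrite (exprD _ (n * b' + j)) (exprD _ (n * b + i)).
  move: (z j) (z i) zj zi (xe (n * b' + j)) (xe (n * b + i)) (xe (n * a)) (xe (n * a')).
  move: (x ^+ _) (x ^+ _) (x ^+ _) (x ^+ _) => A B C D u v u0 v0 A0 B0 C0 D0.
  by field; do ?[apply/andP; split].
have modE c1 c2 (e : 'I_n) : (n * c1 + e + n * c2 = e %[mod n])%N.
  by rewrite addnAC -mulnDr mulnC modnMDl.
move=> /kummer_gen_exp_unit ab.
have : (j = i %[mod n])%N by rewrite -(modE b' a) ab modE.
by rewrite !modn_small // => /ord_inj/eqP; rewrite (negbTE ji).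
Qed.

Lemma kummer_int_unitsE y : int_units iota E y <-> E y /\ vunit O y.
Proof.
split=> [[[Ey Oy] y0 [_ Oy']] | [Ey [Oy y0 Oy']]]; first by split.
by split=> //; split=> //; apply: kummer_fieldV.
Qed.

Lemma kummer_max_idealE y : max_ideal iota E y <-> E y /\ vmax O y.
Proof.
split=> [[[Ey Oy] nU] | [Ey [Oy nU]]].
  by split=> //; split=> // Uy; apply: nU; apply/kummer_int_unitsE.
by split=> // /kummer_int_unitsE[].
Qed.

(** By [kummer_field_value], a nonzero element of the maximal ideal is a unit
    times a positive power of [x]. *)
Lemma kummer_uniformizer : uniformizer iota E x.
Proof.
apply/seteqP; split=> [y /kummer_max_idealE[Ey my] | _ [y [Ey Oy] <-]]; last first.
  apply/kummer_max_idealE; split.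
    by apply: kummer_fieldM => //; exact: kummer_field_gen.
  by rewrite mulrC; apply: (vmaxMl OP) => //; exact: vmax_kummer_gen.
have x0 := kummer_gen_neq0; have xe e : x ^+ e != 0 by rewrite expf_neq0.
exists (y / x); last by rewrite mulrCA divff ?mulr1.
split; first by apply: kummer_fieldM => //; apply/kummer_fieldV/kummer_field_gen.
have [->|y0] := eqVneq y 0; first by rewrite mul0r; exact: (vring0 OP).
have [a [b U]] := kummer_field_value Ey y0.
have [ba|ab] := leqP b a.
  have [_ []] : vmax O (y * x ^+ a / x ^+ b); last exact: U.
  rewrite -mulrA mulrC; apply: (vmaxMl OP) => //.
  rewrite -{1}(subnK ba) exprD mulfK //; apply: (vringX OP).
  by case: vmax_kummer_gen.
rewrite (_ : y / x = (y * x ^+ a / x ^+ b) * x ^+ (b - a.+1)).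
  apply: (vringM OP); first by case: U.
  by apply: (vringX OP); case: vmax_kummer_gen.
have -> : x ^+ b = x ^+ (b - a.+1) * x * x ^+ a.
  by rewrite -exprSr -exprD subnSK // subnK // ltnW.
by field; rewrite x0 !xe.
Qed.

Lemma kummer_tame : ~~ (p %| n)%N -> tame iota p E.
Proof.
move=> pn; split.
- split.
  + split; first by rewrite inE -(rmorph1 iota); exact: kummer_field_base.
      by move=> y z; rewrite !inE; exact: kummer_fieldB.
    move=> y z; rewrite !inE => Ey Ez.
    by apply: kummer_fieldM => //; exact: kummer_fieldV.
  + by move=> _ [c _ <-]; exact: kummer_field_base.
  exists (mkseq (fun i => x ^+ i) n); apply/seteqP; split=> [y|y [c ->]].
    move=> /kummer_field_span[c ->]; exists (fun i => c i).
    rewrite size_mkseq; apply: eq_bigr => i _.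
    by rewrite nth_mkseq.
  exists (\sum_(i < size (mkseq (fun i => x ^+ i) n)) c i *: 'X^i).
  rewrite rmorph_sum horner_sum; apply: eq_bigr => i _.
  rewrite /= map_polyZ map_polyXn hornerZ hornerXn nth_mkseq //.
  by rewrite -[X in (_ < X)%N](size_mkseq (fun i => x ^+ i)).
- move=> y [Ey Oy]; have [c mc] := residue_exists Ks_sep Oy.
  exists ('X - c%:P); first by rewrite unlock derivXsubC coprimep1.
  rewrite rmorphB /= map_polyX map_polyC !hornerE; apply/kummer_max_idealE.
  by split=> //; apply: kummer_fieldB => //; exact: kummer_field_base.
exists n => //; exists x, 1; split; first exact: kummer_uniformizer.
  apply/kummer_int_unitsE; split; last exact: (vunit1 OP).
  by rewrite -(rmorph1 iota); exact: kummer_field_base.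
by rewrite mul1r xn.
Qed.

End KummerExtension.

Section TameQuotient.
Variables (k : closedFieldType) (Ks : fieldType).
Variables (iota : {rmorphism laurent k -> Ks}) (p : nat).
Hypothesis Ks_sep : is_separable_closure iota.
Hypothesis char_k : p \in [pchar k].
Implicit Types s t : galgrp iota.

Lemma wild_inertia_sub_kummer_fixer :
  @wild_inertia k Ks iota p `<=` @kummer_fixer k Ks iota p.
Proof.
move=> s sW n x pn xn; apply: sW; exists (kummer_field iota x).
  apply: (kummer_tame Ks_sep _ xn pn).
  by case: n pn {xn} => //; rewrite dvdn0.
exact: kummer_field_gen.
Qed.

(** An automorphism multiplies an n-th root of t by an n-th root of unity, which
    lies in k and is fixed by all automorphisms; so the actions on these roots
    commute. *)
Lemma kummer_fixer_commutator s t : kummer_fixer p (s * t * (t * s)^-1)%g.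
Proof.
have commute n x : ~~ (p %| n)%N -> x ^+ n = embed_series iota (fps_X k) ->
    (s * t)%g x = (t * s)%g x.
  move=> pn xn; have n0 : (0 < n)%N by case: n pn {xn}; rewrite ?dvdn0.
  have x0 : x != 0 := kummer_gen_neq0 n0 xn.
  have [rs rsE] := closed_field_poly_normal ('X^n - 1%:P : {poly k}).
  have conj (u : galgrp iota) : exists w, u x = embed_const iota w * x.
    have : root (map_poly (embed_const iota) ('X^n - 1%:P)) (u x / x).
      rewrite rmorphB /= map_polyXn map_polyC /root !hornerE /= rmorph1.
      have uxn : u x ^+ n = embed_series iota (fps_X k).
        by rewrite -rmorphXn /= xn gal_embed.
      by rewrite expr_div_n uxn xn divff ?subrr ?unif_neq0.
    rewrite rsE map_polyZ rmorph_prod rootZ ?fmorph_eq0 ?lead_coef_eq0; last first.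
      by rewrite -size_poly_eq0 size_XnsubC.
    rewrite /root horner_prod prodf_seq_eq0 => /hasP[w _ /=].
    rewrite rmorphB /= map_polyX map_polyC !hornerE subr_eq0 => /eqP ux.
    by exists w; rewrite -ux divfK.
  have [v sx] := conj s; have [w tx] := conj t.
  rewrite [LHS]/= [RHS]/= tx sx !rmorphM /= !gal_embed tx sx.
  by rewrite mulrCA.
move=> n x pn xn; set r := (t * s)^-1%g.
have -> : (s * t * r)%g x = (s * t)%g (r x) by [].
rewrite (commute n) //; last by rewrite -rmorphXn /= xn gal_embed.
by rewrite -[LHS]/(((t * s) * r)%g x) mulgV.
Qed.

End TameQuotient.

(** * Extension of characters *)

Section CharacterExtension.
Variables (G : groupType) (C : closedFieldType) (P : set G).
Hypothesis P_commutator : forall x y : G, P (x * y * (y * x)^-1)%g.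

(** Characters of subgroups are functions on the whole group, to avoid a type for
    each subgroup; only the values on [H] count. *)
Record partial_character (H : set G) (th : G -> C) : Prop := {
  partial_char_mul : forall x y, H x -> H y -> H (x * y)%g;
  partial_char_inv : forall x, H x -> H x^-1%g;
  partial_char_sub : P `<=` H;
  partial_char_triv : forall x, P x -> th x = 1;
  partial_char_morph : forall x y, H x -> H y -> th (x * y)%g = th x * th y }.

Section Extend.
Variables (H : set G) (th : G -> C).
Hypothesis Hth : partial_character H th.

Lemma commutators1 : P 1%g.
Proof. by have := P_commutator 1 1; rewrite !mulg1 mulgV. Qed.

Lemma partial_char_one : H 1%g.
Proof. exact/(partial_char_sub Hth)/commutators1. Qed.

Lemma partial_char1 : th 1%g = 1.
Proof. exact/(partial_char_triv Hth)/commutators1. Qed.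

Lemma partial_char_neq0 x : H x -> th x != 0.
Proof.
move=> Hx; have := oner_neq0 C; rewrite -partial_char1 -(mulgV x).
rewrite (partial_char_morph Hth) //; last exact: (partial_char_inv Hth).
by apply: contraNneq => ->; rewrite mul0r.
Qed.

Lemma partial_char_exp x n : H x -> H (x ^+ n)%g /\ th (x ^+ n)%g = th x ^+ n.
Proof.
move=> Hx; elim: n => [|n [Hn thn]].
  by rewrite expg0 expr0 partial_char1; split=> //; exact: partial_char_one.
rewrite expgS exprS (partial_char_morph Hth) // thn; split=> //.
exact: (partial_char_mul Hth).
Qed.

Lemma partial_char_cancel x y : H x -> H (x * y)%g -> H y /\ th (x * y)%g = th x * th y.
Proof.
move=> Hx Hxy; have Hy : H y.
  rewrite -(mulKg x y); apply: (partial_char_mul Hth) => //.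
  exact: (partial_char_inv Hth).
by split=> //; apply: (partial_char_morph Hth).
Qed.

(** The subgroup generated by [H] and [g] is { x | x g ^ i in H for some i };
    a root [mu] of the value at the first power of [g] in [H] serves as the value
    at [g]. *)
Lemma partial_char_extend1 g : (exists m, (0 < m)%N /\ H (g ^+ m)%g) ->
  exists H' th', [/\ partial_character H' th', H `<=` H', H' g &
    forall x, H x -> th' x = th x].
Proof.
case=> m0 [m0_gt0 Hm0].
have ex : exists m, `[< (0 < m)%N /\ H (g ^+ m)%g >] by exists m0; apply/asboolP.
case: (ex_minnP ex) => m /asboolP[m_gt0 Hm] m_min {ex m0 m0_gt0 Hm0}.
have [mu mum] : exists mu, mu ^+ m = th (g ^+ m)%g.
  have /closed_rootP[mu] : size ('X^m - (th (g ^+ m)%g)%:P) != 1%N.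
    by rewrite size_XnsubC // eqSS gtn_eqF.
  by rewrite /root !hornerE subr_eq0 => /eqP; exists mu.
have mu0 : mu != 0.
  have := partial_char_neq0 Hm; rewrite -mum; apply: contraNneq => ->.
  by rewrite expr0n gtn_eqF.
have thg e : H (g ^+ e)%g -> th (g ^+ e)%g = mu ^+ e.
  have [Hq thq] := partial_char_exp (e %/ m) Hm.
  move=> He; have gE : (g ^+ e = (g ^+ m) ^+ (e %/ m) * g ^+ (e %% m))%g.
    by rewrite -expgnA -expgnDr mulnC -divn_eq.
  rewrite gE in He *; have [Hr ->] := partial_char_cancel Hq He.
  have em : (e %% m = 0)%N.
    case: (posnP (e %% m)) => // e_gt0.
    have : (m <= e %% m)%N by apply: m_min; apply/asboolP.
    by rewrite leqNgt ltn_mod m_gt0.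
  rewrite em expg0 partial_char1 mulr1 thq -mum -exprM mulnC.
  by rewrite [in RHS](divn_eq e m) em addn0.
pose H' : set G := [set x | exists i, H (x * g ^+ i)%g].
pose idx x := xget 0%N [set i | H (x * g ^+ i)%g].
pose th' x := th (x * g ^+ idx x)%g / mu ^+ idx x.
have idxP x : H' x -> H (x * g ^+ idx x)%g.
  move=> [i Hi].
  exact: (@xgetPex _ 0%N [set i | H (x * g ^+ i)%g] (ex_intro _ i Hi)).
have mu0' e : mu ^+ e != 0 by rewrite expf_neq0.
have th'E x i : H (x * g ^+ i)%g -> th' x = th (x * g ^+ i)%g / mu ^+ i.
  suff th_le a b : (a <= b)%N -> H (x * g ^+ a)%g -> H (x * g ^+ b)%g ->
      th (x * g ^+ a)%g / mu ^+ a = th (x * g ^+ b)%g / mu ^+ b.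
    move=> Hi; have Hidx : H (x * g ^+ idx x)%g by apply: idxP; exists i.
    by rewrite /th'; have [le|/ltnW le] := leqP (idx x) i; [|symmetry]; apply: th_le.
  move=> /subnKC ab Ha; rewrite -ab expgnDr mulgA => Hab.
  have [Hg ->] := partial_char_cancel Ha Hab.
  by rewrite thg // exprD invfM mulrACA divff // mulr1.
(* Commuting g past y, and then the commutator past x, costs elements of P. *)
have swap x y i j : exists c c', [/\ P c, P c' &
    ((x * g ^+ i) * (y * g ^+ j) = c' * (c * (x * y * g ^+ (i + j))))%g].
  pose c := (g ^+ i * y * (y * g ^+ i)^-1)%g.
  exists c, (x * c * (c * x)^-1)%g; split; [exact: P_commutator|exact: P_commutator|].
  have cy : (c * (y * g ^+ i) = g ^+ i * y)%g by rewrite mulgVK.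
  have -> : (c * (x * y * g ^+ (i + j)%N) = c * x * (y * g ^+ i * g ^+ j))%g.
    by rewrite expgnDr !mulgA.
  by rewrite [RHS]mulgA mulgVK -[RHS]mulgA [(c * _)%g]mulgA cy !mulgA.
have th'H x : H x -> H' x /\ th' x = th x.
  move=> Hx; have Hx0 : H (x * g ^+ 0)%g by rewrite expg0 mulg1.
  by split; [exists 0%N | rewrite (th'E _ _ Hx0) expg0 mulg1 expr0 divr1].
have HP := partial_char_sub Hth.
exists H', th'; split; last by move=> x /th'H[].
- split.
  + move=> x y [i Hi] [j Hj]; exists (i + j)%N.
    have [c [c' [Pc Pc' E]]] := swap x y i j.
    have := partial_char_mul Hth Hi Hj.
    rewrite E => /(partial_char_cancel (HP _ Pc'))[+ _].
    by case/(partial_char_cancel (HP _ Pc)).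
  + move=> x [i Hi]; exists (i * m.-1)%N.
    have [c [c' [Pc Pc' E]]] := swap x x^-1%g i (i * m.-1)%N.
    suff /(partial_char_cancel Hi)[] :
      H ((x * g ^+ i) * (x^-1 * g ^+ (i * m.-1)))%g by [].
    rewrite E mulgV mul1g -mulnS prednK // mulnC expgnA.
    apply: (partial_char_mul Hth); first exact: HP.
    by apply: (partial_char_mul Hth); [exact: HP | exact: (partial_char_exp _ Hm).1].
  + by move=> x /HP/th'H[].
  + by move=> x Px; have [_ ->] := th'H _ (HP _ Px); exact: (partial_char_triv Hth).
  + move=> x y [i Hi] [j Hj]; have [c [c' [Pc Pc' E]]] := swap x y i j.
    have := partial_char_mul Hth Hi Hj.
    rewrite E => /(partial_char_cancel (HP _ Pc'))[H1 E1].
    have [H2 E2] := partial_char_cancel (HP _ Pc) H1.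
    rewrite (th'E _ _ H2) (th'E _ _ Hi) (th'E _ _ Hj) mulrACA.
    rewrite -(partial_char_morph Hth) // E E1 E2.
    rewrite (partial_char_triv Hth Pc) (partial_char_triv Hth Pc').
    by rewrite !mul1r exprD invfM.
- by move=> x /th'H[].
by exists m.-1; rewrite -expgS prednK.
Qed.

End Extend.

(** The units of an algebraically closed field form a divisible group, so
    characters extend from subgroups; here finitely many steps are enough. *)
Lemma partial_char_extend (H : set G) (th : G -> C) (gs : seq G) :
    partial_character H th -> (forall g, exists m, (0 < m)%N /\ H (g ^+ m)%g) ->
  exists H' th', [/\ partial_character H' th', H `<=` H',
    {in gs, forall g, H' g} & forall x, H x -> th' x = th x].
Proof.
move=> Hth tors; elim: gs => [|g gs [H1 [th1 [Hth1 HH1 gsH1 th1E]]]].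
  by exists H, th; split.
have [|H2 [th2 [Hth2 H12 gH2 th2E]]] := partial_char_extend1 Hth1 (g := g).
  by have [m [m0 Hm]] := tors g; exists m; split=> //; apply: HH1.
exists H2, th2; split=> //.
- by move=> x /HH1/H12.
- by move=> x; rewrite inE => /orP[/eqP->|/gsH1/H12].
by move=> x Hx; rewrite th2E ?th1E //; apply: HH1.
Qed.

End CharacterExtension.

(** * Ultrametric matrices and the topologies *)

Section UltrametricMatrices.
Variables (R : realType) (C : fieldType) (b : C -> R).
Hypothesis bP : is_absolute_value b.

Let b_ge0 x : 0 <= b x. Proof. exact: (abs_ge0 bP). Qed.

Lemma abs_zero : b 0 = 0.
Proof. exact/(abs_eq0 bP). Qed.

Lemma abs_neq0 x : (b x != 0) = (x != 0).
Proof.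
congr (~~ _); apply/eqP/eqP => [/(abs_eq0 bP) //|->]; exact: abs_zero.
Qed.

Lemma abs_one : b 1 = 1.
Proof.
have b1 : b 1 != 0 by rewrite abs_neq0 oner_neq0.
by apply: (mulfI b1); rewrite -(absM bP) !mulr1.
Qed.

Lemma abs_opp x : b (- x) = b x.
Proof.
have bN1 : b (-1) = 1.
  have : b (-1) ^+ 2 = 1 by rewrite expr2 -(absM bP) mulrNN mulr1 abs_one.
  move/eqP; rewrite sqrf_eq1 => /orP[/eqP //|/eqP bN].
  by have := b_ge0 (-1); rewrite bN oppr_ge0 ler10.
by rewrite -mulN1r (absM bP) bN1 mul1r.
Qed.

Lemma abs_distC x y : b (x - y) = b (y - x).
Proof. by rewrite -abs_opp opprB. Qed.

Lemma absX x n : b (x ^+ n) = b x ^+ n.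
Proof. by elim: n => [|n IHn]; rewrite ?expr0 ?abs_one // !exprS (absM bP) IHn. Qed.

Lemma absV x : b x^-1 = (b x)^-1.
Proof.
have [->|x0] := eqVneq x 0; first by rewrite invr0 abs_zero invr0.
have bx0 : b x != 0 by rewrite abs_neq0.
by apply: (mulfI bx0); rewrite -(absM bP) divff // abs_one divff.
Qed.

Lemma abs_add_le x y e : b x <= e -> b y <= e -> b (x + y) <= e.
Proof. by move=> bx by_; apply: (le_trans (abs_ultra bP _ _)); rewrite ge_max bx. Qed.

Lemma abs_add_lt x y e : b x < e -> b y < e -> b (x + y) < e.
Proof. by move=> bx by_; apply: (le_lt_trans (abs_ultra bP _ _)); rewrite gt_max bx. Qed.

Lemma abs_sum_le (I : Type) (r : seq I) (P : pred I) (x : I -> C) e :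
  0 <= e -> (forall i, P i -> b (x i) <= e) -> b (\sum_(i <- r | P i) x i) <= e.
Proof.
move=> e0 xe; elim/big_rec: _ => [|i y /xe]; first by rewrite abs_zero.
exact: abs_add_le.
Qed.

Lemma abs_nat_le1 n : b n%:R <= 1.
Proof.
elim: n => [|n IHn]; first by rewrite abs_zero.
by rewrite -natr1; apply: abs_add_le => //; rewrite abs_one.
Qed.

Variable d : nat.
Implicit Types A B Q : 'M[C]_d.

Definition mx_abs_le A (e : R) := forall i j, b (A i j) <= e.

Lemma mx_abs_leD A B e : mx_abs_le A e -> mx_abs_le B e -> mx_abs_le (A + B) e.
Proof. by move=> Ae Be i j; rewrite mxE; apply: abs_add_le. Qed.

Lemma mx_abs_leM A B e f : 0 <= e -> 0 <= f ->
  mx_abs_le A e -> mx_abs_le B f -> mx_abs_le (A *m B) (e * f).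
Proof.
move=> e0 f0 Ae Bf i j; rewrite mxE; apply: abs_sum_le; first exact: mulr_ge0.
by move=> l _; rewrite (absM bP) ler_pM.
Qed.

Lemma mx_abs_le_nat n : mx_abs_le (1 *+ n) 1.
Proof.
move=> i j; rewrite mulmxnE mxE; case: (i == j); first exact: abs_nat_le1.
by rewrite mul0rn abs_zero.
Qed.

(** The start of the binomial expansion, with an integral remainder. *)
Lemma expr1D_ultrametric B n : mx_abs_le B 1 ->
  exists2 Q, mx_abs_le Q 1 & (1 + B) ^+ n = 1 + B *+ n + B * B * Q.
Proof.
move=> B1; elim: n => [|n [Q Q1 IHn]].
  exists 0; last by rewrite expr0 mulr0n mulr0 !addr0.
  by move=> i j; rewrite mxE abs_zero.
exists (1 *+ n + Q + B * Q).
  do ?apply: mx_abs_leD => //; first exact: mx_abs_le_nat.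
  by rewrite -[1 : R]mulr1; apply: mx_abs_leM.
rewrite exprS IHn mulrDl mul1r !mulrDr mulr1 !mulrnAr mulr1 !mulrA mulrS.
by rewrite (AC (3 * 3) ((1 * (4 * 2)) * ((5 * 3) * 6))).
Qed.

(** A matrix B with entries of absolute value at most c < 1 satisfies
    (1 + B) ^ n - 1 = n B + O(c ^ 2); when |n| = 1 this has the size of B. *)
Lemma mx_pow_away_from1 A n : b n%:R = 1 -> A != 1 ->
    (forall i j, b ((A - 1) i j) < 1) ->
  exists2 c, 0 < c & forall m, exists i j, c <= b ((A ^+ (n ^ m) - 1) i j).
Proof.
move=> bn A1 lt1; pose B := A - 1.
have [[i0 j0] /= B0] : exists ij : 'I_d * 'I_d, B ij.1 ij.2 != 0.
  apply: contrapT => B0; case/negP: A1; rewrite -subr_eq0; apply/eqP/matrixP => i j.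
  by rewrite [RHS]mxE; apply/eqP/negPn/negP => Bij; apply: B0; exists (i, j).
have [[i j] _ /= ij_max] := arg_maxP (fun ij : 'I_d * 'I_d => b (B ij.1 ij.2))
  (erefl true : xpredT (i0, j0)).
set c := b (B i j) in ij_max.
have c0 : 0 < c.
  by apply: lt_le_trans (ij_max (i0, j0) isT); rewrite lt_def abs_neq0 B0 b_ge0.
have c1 : c < 1 := lt1 i j.
exists c => // m; exists i, j.
have BC : mx_abs_le B c by move=> i' j'; exact: (ij_max (i', j') isT).
have [|Q Q1] := expr1D_ultrametric (n ^ m) (B := B).
  by move=> i' j'; apply/ltW/lt1.
rewrite {1}/B addrC subrK => AE.
have {}AE : A ^+ (n ^ m) - 1 = B *+ (n ^ m) + B * B * Q.
  by rewrite AE -[1 + _ + _]addrA [1 + _]addrC addrK.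
have BBQ : b ((B * B * Q) i j) < c.
  apply: (@le_lt_trans _ _ (c * c * 1)); last by rewrite mulr1 gtr_pMr.
  apply: mx_abs_leM => //; first by rewrite mulr_ge0 ?ltW.
  by apply: mx_abs_leM => //; exact: ltW.
rewrite leNgt AE; apply/negP => lt_c.
have : b ((B *+ (n ^ m)) i j) < c.
  rewrite -[B *+ _](addrK (B * B * Q)) mxE [X in _ + X]mxE.
  by apply: abs_add_lt => //; rewrite abs_opp.
by rewrite mulmxnE -mulr_natl (absM bP) natrX absX bn expr1n mul1r ltxx.
Qed.

End UltrametricMatrices.

Section Topology.
Variables (K L : fieldType) (f : {rmorphism K -> L}).

Lemma krull_nbhsP (s : galgrp f) (U : set (galgrp f)) :
  nbhs s U <-> exists r : seq L, forall t : galgrp f, {in r, t =1 s} -> U t.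
Proof.
split=> [|[r rU]].
  by rewrite nbhsE => -[V [oV Vs] VU]; have [r rV] := oV s Vs; exists r => t /rV/VU.
rewrite nbhsE; exists [set t : galgrp f | {in r, t =1 s}] => //; split=> //.
by move=> t rt; exists r => u ru x xr; rewrite ru // rt.
Qed.

Variables (R : realType) (C : fieldType) (b : C -> R).
Hypothesis bP : is_absolute_value b.

Lemma abs_nbhsP (x : C) (U : set C) :
  nbhs (x : abs_top b) U <-> exists2 e : R, 0 < e & forall y, b (y - x) < e -> U y.
Proof.
split=> [|[e e0 eU]].
  rewrite nbhsE => -[V [oV Vx] VU]; have [e e0 eV] := oV x Vx.
  by exists e => // y /eV/VU.
rewrite nbhsE; exists [set y : abs_top b | b ((y : C) - x) < e]; last by move=> y /eU.
split; last by rewrite /= subrr (abs_zero bP).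
move=> y yx; exists e => // z zy /=.
by rewrite -(subrK (y : C) (z : C)) -addrA; apply: (abs_add_lt bP).
Qed.

Lemma continuous_rep_at (V : vectType C) (rho : galgrp f -> 'End(V))
    (s : galgrp f) (e : R) :
    continuous_rep b rho -> 0 < e ->
  exists r : seq L, forall t : galgrp f, {in r, t =1 s} -> forall i j,
    b (passmx.mxof (vbasis {:V}) (vbasis {:V}) (rho t) i j
       - passmx.mxof (vbasis {:V}) (vbasis {:V}) (rho s) i j) < e.
Proof.
move=> /(_ s) cont e0; pose M t := passmx.mxof (vbasis {:V}) (vbasis {:V}) (rho t).
pose U : set 'M[abs_top b]_(\dim {:V}) :=
  [set A | forall i j, b ((A i j : C) - M s i j) < e].
have /cont/krull_nbhsP[r rU] : nbhs (M s : 'M[abs_top b]_(\dim {:V})) U.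
  exists (fun i j => [set y : abs_top b | b ((y : C) - M s i j) < e]) => //.
  by move=> i j; apply/abs_nbhsP; exists e.
by exists r => t /rU.
Qed.

End Topology.

(** * Finite quotients of the Galois group *)

Section FiniteQuotients.
Variables (k Ks : fieldType) (iota : {rmorphism laurent k -> Ks}).
Hypothesis Ks_alg : forall x, algebraicOver iota x.
Implicit Types s t : galgrp iota.

Definition fixes (r : seq Ks) : set (galgrp iota) :=
  [set s : galgrp iota | {in r, forall x, s x = x}].

Lemma gal_mulE s t x : (s * t)%g x = s (t x).
Proof. by []. Qed.

Lemma galK s : cancel s (s^-1)%g.
Proof. by move=> x; rewrite -gal_mulE mulVg. Qed.

Lemma galVK s : cancel (s^-1)%g s.
Proof. by move=> x; rewrite -gal_mulE mulgV. Qed.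

(** An automorphism is determined modulo the fixer of [r] by the permutation of
    [r] that it induces, and these are finite in number. *)
Lemma exists_representatives (r : seq Ks) : galois_stable iota r ->
  exists gs : seq (galgrp iota), forall s,
    exists2 g, g \in gs & fixes r (g^-1 * s)%g.
Proof.
move=> st; have lt_r s (i : 'I_(size r)) : (index (s r`_i)%R r < size r)%N.
  by rewrite index_mem st // mem_nth.
pose phi s := [ffun i : 'I_(size r) => Ordinal (lt_r s i)].
pose rep f := xget 1%g [set s | phi s = f].
exists [seq rep f | f : {ffun 'I_(size r) -> 'I_(size r)}] => s.
exists (rep (phi s)); first by apply/mapP; exists (phi s); rewrite ?mem_enum.
have phi_rep : phi (rep (phi s)) = phi s.
  exact: (@xgetPex _ 1%g [set t | phi t = phi s] (ex_intro _ s erefl)).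
move=> x xr; rewrite gal_mulE; apply: (canLR (galK _)).
have xi : (index x r < size r)%N by rewrite index_mem.
have /ffunP/(_ (Ordinal xi))/(congr1 val) := phi_rep.
rewrite !ffunE /= nth_index // => /(congr1 (nth 0 r)).
by rewrite !nth_index ?st.
Qed.

Lemma iter_period (T : Type) (f : T -> T) m c x :
  iter m f x = x -> iter (m * c) f x = x.
Proof. by move=> fx; elim: c => [|c IHc]; rewrite ?muln0 // mulnS iterD IHc. Qed.

(** [S] is used for the positive integers and for the powers of [p]. *)
Lemma common_period (S : set nat) s (r : seq Ks) :
    S 1%N -> (forall m n, S m -> S n -> S (m * n)%N) ->
    (forall x, exists2 m, S m & iter m s x = x) ->
  exists2 m, S m & fixes r (s ^+ m)%g.
Proof.
move=> S1 SM per; elim: r => [|x r [m Sm mr]]; first by exists 1%N.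
have [m' Sm' m'x] := per x; exists (m * m')%N; first exact: SM.
move=> y; rewrite gal_expg inE => /orP[/eqP->|yr].
  by rewrite mulnC iter_period.
by rewrite iter_period // -gal_expg mr.
Qed.

Lemma fixes_torsion s (r : seq Ks) : exists m, (0 < m)%N /\ fixes r (s ^+ m)%g.
Proof.
have [||x|m m0 mr] := @common_period [set m | (0 < m)%N] s r; last by exists m.
- by [].
- by move=> m n /= m0 n0; rewrite muln_gt0 m0.
have [i [j [ij xij]]] := gal_orbit Ks_alg s x.
exists (j - i)%N; first by rewrite /= subn_gt0.
apply: (can_inj (galK (s ^+ i)%g)).
by rewrite !gal_expg -iterD subnKC // ltnW.
Qed.

Lemma fixes_mul r s t : fixes r s -> fixes r t -> fixes r (s * t)%g.
Proof. by move=> rs rt x xr; rewrite gal_mulE rt ?rs. Qed.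

Lemma fixes_inv r s : fixes r s -> fixes r s^-1%g.
Proof. by move=> rs x xr; rewrite -{1}(rs x xr) galK. Qed.

Lemma fixes_commutator r s t : galois_stable iota r -> fixes r t ->
  fixes r (s * t * (t * s)^-1)%g.
Proof.
move=> st rt x xr; rewrite !gal_mulE; set y := (t * s)^-1%g x.
have yr : y \in r by apply: st.
by rewrite rt // -(rt (s y)) ?st // -gal_mulE galVK.
Qed.

End FiniteQuotients.

Section KummerAgreement.
Variables (k Ks : fieldType) (iota : {rmorphism laurent k -> Ks}) (p : nat).
Implicit Types s t : galgrp iota.
Local Notation KF := (@kummer_fixer k Ks iota p).

Lemma kummer_fixer_mul s t : KF s -> KF t -> KF (s * t)%g.
Proof. by move=> sK Kt n x pn xn; rewrite gal_mulE (Kt n) ?(sK n). Qed.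

Lemma kummer_fixer_inv s : KF s -> KF s^-1%g.
Proof. by move=> sK n x pn xn; rewrite -{1}(sK n x pn xn) galK. Qed.

Lemma kummer_fixer_conj s t : KF t -> KF (s^-1 * t * s)%g.
Proof.
move=> Kt n x pn xn; rewrite !gal_mulE (Kt n) ?galK //.
by rewrite -rmorphXn /= xn gal_embed.
Qed.

End KummerAgreement.

(** * Representations *)

(** A prime other than l is an l-adic unit. *)
Lemma padic_abs_prime (R : realType) (p l : nat) (Ql : fieldType) (a : Ql -> R)
    (C : closedFieldType) (j : {rmorphism Ql -> C}) (b : C -> R) :
    is_padic_field l a -> is_valued_closure a j b ->
    prime p -> prime l -> l != p -> b p%:R = 1.
Proof.
move=> Ql_padic Cb pr_p pr_l lp.
rewrite -(rmorph_nat j) (closure_abs_ext Cb) -(@ratr_nat Ql) (padic_abs_rat Ql_padic).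
rewrite /padic_abs pnatr_eq0 gtn_eqF ?prime_gt0 //.
have -> : p%:R = p%:Z%:Q by [].
by rewrite numq_int denq_int !absz_nat logn1 logn_prime // (negbTE lp) subrr expr0z.
Qed.

Section MatrixOfRepresentation.
Variables (G : groupType) (C : fieldType) (V : vectType C) (rho : G -> 'End(V)).
Hypothesis rho_rep : is_representation rho.

Definition rep_mx s : 'M[C]_(\dim {:V}) :=
  mxof (vbasis {:V}) (vbasis {:V}) (rho s).

Let basisV := vbasisP {:V}.

Lemma rep_mx1 : rep_mx 1%g = 1.
Proof. by rewrite /rep_mx rho_rep.1 mxof1 // (basis_free basisV). Qed.

Lemma rep_mxM s t : rep_mx (s * t)%g = rep_mx t *m rep_mx s.
Proof. by rewrite /rep_mx rho_rep.2 (mxof_comp _ _ basisV). Qed.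

Lemma rep_mxX s n : rep_mx (s ^+ n)%g = rep_mx s ^+ n.
Proof.
elim: n => [|n IHn]; first by rewrite expg0 rep_mx1 expr0.
by rewrite expgS rep_mxM IHn exprSr.
Qed.

Lemma rep_mx_inj s t : rep_mx s = rep_mx t -> rho s = rho t.
Proof. exact: (can_inj (mxofK basisV basisV)). Qed.

Lemma rep_mx_scalar s c : rho s = c *: \1%VF -> rep_mx s = c%:M.
Proof.
move=> rs; rewrite /rep_mx rs linearZ /= mxof1 ?(basis_free basisV) //.
by rewrite scalemx1.
Qed.

End MatrixOfRepresentation.

(** Schur's lemma: an eigenspace of [h] is stable. *)
Lemma schur (G : groupType) (C : closedFieldType) (V : vectType C)
    (rho : G -> 'End(V)) (h : 'End(V)) :
    irreducible rho -> (forall s, (rho s \o h)%VF = (h \o rho s)%VF) ->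
  exists c, h = c *: \1%VF.
Proof.
move=> [V0 irr] comm_h; have basisV := vbasisP {:V}.
have d0 : (0 < \dim {:V})%N by rewrite lt0n dimv_eq0; apply/eqP.
pose A := mxof (vbasis {:V}) (vbasis {:V}) h.
have [c cA] : exists c, root (char_poly A) c.
  by apply/closed_rootP; rewrite size_char_poly eqSS gtn_eqF.
pose U := lker (h - c *: \1%VF).
have UE u : (u \in U) = (h u == c *: u).
  by rewrite memv_ker add_lfunE opp_lfunE scale_lfunE id_lfunE subr_eq0.
exists c; move: cA; rewrite -eigenvalue_root_char => /eigenvalueP[v vA v0].
have vU : vecof (vbasis {:V}) v \in U.
  by rewrite UE (hom_vecof _ basisV) -/A vA linearZ.
have [s|U0|UT] := irr U.
- apply/subvP => _ /memv_imgP[u uU ->]; move: uU; rewrite !UE => /eqP hu.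
  by have /lfunP/(_ u) := comm_h s; rewrite !comp_lfunE hu linearZ => <-.
- by move: vU; rewrite U0 memv0 (vecof_eq0 basisV) (negbTE v0).
apply/lfunP => u; have : u \in U by rewrite UT memvf.
by rewrite UE scale_lfunE id_lfunE => /eqP.
Qed.

(** * The twisting character *)

Section FiniteTwist.
Variables (k : closedFieldType) (Ks : fieldType).
Variables (iota : {rmorphism laurent k -> Ks}) (p : nat).
Hypothesis Ks_sep : is_separable_closure iota.
Hypothesis char_k : p \in [pchar k].
Variables (R : realType) (C : closedFieldType) (b : C -> R).
Hypothesis bP : is_absolute_value b.
Hypothesis bp : b p%:R = 1.
Variables (V : vectType C) (rho : galgrp iota -> 'End(V)).
Hypothesis rho_rep : is_representation rho.
Hypothesis rho_cont : continuous_rep b rho.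

Implicit Types s t : galgrp iota.
Local Notation KF := (@kummer_fixer k Ks iota p).
Local Notation Ks_alg := (separable_closure_algebraic Ks_sep).

Lemma rep_near1 (e : R) : 0 < e -> exists r : seq Ks,
  forall t, fixes r t -> forall i j, b ((rep_mx rho t - 1) i j) < e.
Proof.
move=> e0; have [r rP] := continuous_rep_at bP (1%g : galgrp iota) rho_cont e0.
exists r => t rt i j; rewrite -(rep_mx1 rho_rep) [X in b X]mxE [X in _ + X]mxE.
by apply: rP => x xr; rewrite rt.
Qed.

(** The powers s ^ (p ^ a) of an element fixing the roots of t tend to 1, while
    those of a matrix close to 1 stay at a constant distance from 1. *)
Lemma kummer_fixer_rep1 (r : seq Ks) s :
    (forall t, fixes r t -> forall i j, b ((rep_mx rho t - 1) i j) < 1) ->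
  fixes r s -> KF s -> rho s = \1%VF.
Proof.
move=> r1 rs sK; rewrite -rho_rep.1; apply: (rep_mx_inj (rho := rho)).
rewrite (rep_mx1 rho_rep); apply/eqP/negPn/negP => s1.
have [c c0 cP] := mx_pow_away_from1 bP bp s1 (r1 s rs).
have [r' r'P] := rep_near1 c0.
have [||x|m [a _ <-] mr'] := @common_period _ _ _ (range (fun a => p ^ a)%N) s r'.
- by exists 0%N.
- by move=> _ _ [a1 _ <-] [a2 _ <-]; exists (a1 + a2)%N; rewrite // expnD.
- have [a xa] := kummer_fixer_pro_p Ks_sep char_k x sK.
  by exists (p ^ a)%N => //; exists a.
have [i [j cij]] := cP a.
by have := r'P _ mr' i j; rewrite (rep_mxX rho_rep) ltNge cij.
Qed.

Hypothesis rho_irr : irreducible rho.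

Section Scalars.
Variable r : seq Ks.
Hypothesis r_stable : galois_stable iota r.
Hypothesis r_small : forall t, fixes r t -> forall i j, b ((rep_mx rho t - 1) i j) < 1.

(** A commutator with an element of the fixer of [r] lies in this fixer, which is
    normal, and fixes the roots of t, so it acts trivially by
    [kummer_fixer_rep1]. *)
Lemma fixer_scalar s : fixes r s -> exists c, rho s = c *: \1%VF.
Proof.
move=> rs; apply: (schur rho_irr) => t; rewrite -!rho_rep.2.
have : rho (t * s * (s * t)^-1)%g = \1%VF.
  apply: (kummer_fixer_rep1 r_small); first exact: fixes_commutator.
  exact: kummer_fixer_commutator.
move=> comm1; have tsE : (t * s = t * s * (s * t)^-1 * (s * t))%g by rewrite mulgVK.
by rewrite [in LHS]tsE rho_rep.2 comm1 comp_lfun1l.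
Qed.

Lemma irr_dim_gt0 : (0 < \dim {:V})%N.
Proof. by rewrite lt0n dimv_eq0; apply/eqP; case: rho_irr. Qed.

Definition rep_scalar s : C := rep_mx rho s (Ordinal irr_dim_gt0) (Ordinal irr_dim_gt0).

Lemma rep_scalarP s : fixes r s -> rho s = rep_scalar s *: \1%VF.
Proof.
move=> /fixer_scalar[c rs].
by rewrite /rep_scalar (rep_mx_scalar rs) mxE eqxx mulr1n.
Qed.

Lemma rep_scalarM s t : fixes r s -> fixes r t ->
  rep_scalar (s * t)%g = rep_scalar s * rep_scalar t.
Proof.
move=> rs rt.
have E : rep_mx rho (s * t)%g = (rep_scalar s * rep_scalar t)%:M.
  rewrite (rep_mxM rho_rep) (rep_mx_scalar (rep_scalarP rs)).
  by rewrite (rep_mx_scalar (rep_scalarP rt)) -scalar_mxM mulrC.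
by rewrite [LHS]/rep_scalar E mxE eqxx mulr1n.
Qed.

Lemma rep_scalar1 : rep_scalar 1%g = 1.
Proof. by rewrite /rep_scalar (rep_mx1 rho_rep) mxE eqxx. Qed.

Lemma rep_scalar_eq s t : fixes r s -> fixes r t -> KF (s^-1 * t)%g ->
  rep_scalar s = rep_scalar t.
Proof.
move=> rs rt Kst; have rst : fixes r (s^-1 * t)%g.
  by apply: fixes_mul => //; apply: fixes_inv.
have := rep_scalarM rs rst; rewrite mulVKg => ->.
have E : rho (s^-1 * t)%g = 1 *: \1%VF.
  by rewrite scale1r; apply: (kummer_fixer_rep1 r_small).
by rewrite [X in _ * X]/rep_scalar (rep_mx_scalar E) mxE eqxx mulr1.
Qed.

Lemma rep_scalar_neq0 s : fixes r s -> rep_scalar s != 0.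
Proof.
move=> rs; have := rep_scalarM rs (fixes_inv rs); rewrite mulgV rep_scalar1.
by move/eqP; apply: contraTneq => ->; rewrite mul0r oner_eq0.
Qed.

(** The subgroup is the product of the fixer of [r] and the fixer of the roots of
    t. The value at [s] comes from any element of the former that acts like [s] on
    the roots of t; [rep_scalar_eq] makes this independent of the choice. *)
Lemma inverse_scalar_partial_char : exists H th,
  [/\ partial_character KF H th, fixes r `<=` H &
      forall s, fixes r s -> th s = (rep_scalar s)^-1].
Proof.
pose H : set (galgrp iota) := [set s | exists n, fixes r n /\ KF (n^-1 * s)%g].
pose part s := xget 1%g [set n : galgrp iota | fixes r n /\ KF (n^-1 * s)%g].
have partP s : H s -> fixes r (part s) /\ KF ((part s)^-1 * s)%g.
  exact: (@xgetPex _ 1%g [set n : galgrp iota | fixes r n /\ KF (n^-1 * s)%g]).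
have partE n s : fixes r n -> KF (n^-1 * s)%g -> rep_scalar (part s) = rep_scalar n.
  move=> rn Kns; have [|rp Kp] := partP s; first by exists n.
  apply: rep_scalar_eq => //.
  have -> : ((part s)^-1 * n = ((part s)^-1 * s) * (n^-1 * s)^-1)%g.
    by rewrite invgM invgK mulgA mulgK.
  by apply: kummer_fixer_mul => //; apply: kummer_fixer_inv.
have prodP s t m n : KF (m^-1 * s)%g -> KF (n^-1 * t)%g -> KF ((m * n)^-1 * (s * t))%g.
  move=> Km Kn.
  have -> : ((m * n)^-1 * (s * t) = (n^-1 * (m^-1 * s) * n) * (n^-1 * t))%g.
    by rewrite invgM !mulgA mulgK.
  by apply: kummer_fixer_mul => //; apply: kummer_fixer_conj.
have K1 : KF 1%g by [].
have r1 : fixes r (1%g : galgrp iota) by [].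
exists H, (fun s => (rep_scalar (part s))^-1); split.
- split.
  + move=> s t [m [rm Km]] [n [rn Kn]]; exists (m * n)%g; split; last exact: prodP.
    exact: fixes_mul.
  + move=> s [n [rn Kn]]; exists n^-1%g; split; first exact: fixes_inv.
    have -> : (n^-1^-1 * s^-1 = (n^-1)^-1 * (n^-1 * s)^-1 * n^-1)%g.
      by rewrite invgM !invgK mulgA mulgK.
    by apply: kummer_fixer_conj; apply: kummer_fixer_inv.
  + by move=> s Ks'; exists 1%g; rewrite invg1 mul1g.
  + by move=> s Ks'; rewrite (partE 1%g) ?invg1 ?mul1g // rep_scalar1 invr1.
  + move=> s t /partP[rm Km] /partP[rn Kn].
    by rewrite (partE (part s * part t)%g) ?rep_scalarM ?invfM //;
      [exact: fixes_mul | exact: prodP].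
- by move=> s rs; exists s; rewrite mulVg.
by move=> s rs; rewrite (partE s) // mulVg.
Qed.

End Scalars.

(** The twist is trivial on the open subgroup fixing [r], which has finite index,
    and continuity of the character has to be checked on this subgroup alone. *)
Lemma exists_finite_twist : exists chi : galgrp iota -> C,
  [/\ is_character chi, continuous_char b chi,
      (forall s, KF s -> chi s = 1) & finite_set (range (twist rho chi))].
Proof.
have [r0 r0_small] := rep_near1 (@ltr01 R).
have [r r0r r_stable] := exists_stable Ks_alg r0.
have fixr0 t : fixes r t -> fixes r0 t by move=> rt x /r0r/rt.
have r_small t (rt : fixes r t) := r0_small t (fixr0 t rt).
have [H [th [Hth rH thE]]] := inverse_scalar_partial_char r_stable r_small.
have [gs gsP] := exists_representatives r_stable.
have [||H' [chi [Hchi HH' gsH' chiE]]] := partial_char_extend _ gs Hth.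
- exact: kummer_fixer_commutator.
- move=> g; have [m [m0 rm]] := fixes_torsion Ks_alg g r.
  by exists m; split=> //; apply: rH.
have H'T s : H' s.
  have [g ggs rg] := gsP s; rewrite -(mulVKg g s).
  by apply: (partial_char_mul Hchi); [exact: gsH' | exact/HH'/rH].
have chiM s t : chi (s * t)%g = chi s * chi t by exact: (partial_char_morph Hchi).
have chiK s : KF s -> chi s = 1 by exact: (partial_char_triv Hchi).
have chi_r s : fixes r s -> chi s = (rep_scalar s)^-1.
  by move=> rs; rewrite chiE ?thE //; apply: rH.
exists chi; split=> //.
- by split=> //; exact: chiK.
- move=> s; apply: (_ : forall U, nbhs (chi s : abs_top b) U -> nbhs s (chi @^-1` U)).
  move=> U /(abs_nbhsP bP)[e e0 eU]; apply/krull_nbhsP.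
  have chis0 : chi s != 0.
    by apply: (partial_char_neq0 _ Hchi) => //; exact: kummer_fixer_commutator.
  have bs0 : 0 < b (chi s) by rewrite lt_def abs_neq0 // chis0 (abs_ge0 bP).
  pose e' := Num.min 1 (e / b (chi s)).
  have [|r' r'_small] := @rep_near1 e'; first by rewrite lt_min ltr01 divr_gt0.
  exists (r ++ r') => t ts; apply: eU.
  have rt : fixes r (s^-1 * t)%g.
    by move=> x xr; rewrite gal_mulE ts ?galK // mem_cat xr.
  have rt' : fixes r' (s^-1 * t)%g.
    by move=> x xr; rewrite gal_mulE ts ?galK // mem_cat xr orbT.
  set u := (s^-1 * t)%g in rt rt'.
  have := r'_small _ rt' (Ordinal irr_dim_gt0) (Ordinal irr_dim_gt0).
  rewrite mxE [X in b (_ + X)]mxE [X in b (_ - X) < e']mxE eqxx mulr1n.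
  rewrite -/(rep_scalar u) lt_min => /andP[lam1 lame].
  have lam0 := rep_scalar_neq0 r_stable r_small rt.
  have blam : b (rep_scalar u) = 1.
    have lamD := subrK 1 (rep_scalar u).
    apply/eqP; rewrite eq_le -{1}lamD; apply/andP; split.
      by apply: (abs_add_le bP); [exact: ltW | rewrite (abs_one bP)].
    rewrite leNgt; apply/negP => lt1; have := ltxx (1 : R).
    rewrite -{1}(abs_one bP) -(subKr (rep_scalar u) 1) => /negP; apply.
    by apply: (abs_add_lt bP) => //; rewrite (abs_opp bP).
  have -> : chi t - chi s = chi s * ((rep_scalar u)^-1 * (1 - rep_scalar u)).
    have -> : chi t = chi s * chi u by rewrite -chiM mulVKg.
    by rewrite (chi_r _ rt) mulrBr mulr1 mulVf // mulrBr mulr1.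
  rewrite !(absM bP) (absV bP) blam invr1 mul1r (abs_distC bP).
  by rewrite mulrC -ltr_pdivlMr.
apply: (@sub_finite_set _ _ [set` [seq twist rho chi g | g <- gs]]);
  last exact: finite_seq.
move=> _ [s _ <-] /=; have [g ggs rg] := gsP s; apply/mapP; exists g => //.
have -> : s = (g * (g^-1 * s))%g by rewrite mulVKg.
move: (g^-1 * s)%g rg => u ru; rewrite /twist chiM rho_rep.2 (rep_scalarP _ _ ru) //.
apply/lfunP => v; rewrite !scale_lfunE comp_lfunE scale_lfunE id_lfunE linearZ /=.
rewrite scalerA -mulrA (chi_r _ ru) mulVf ?mulr1 //.
exact: (rep_scalar_neq0 r_stable r_small).
Qed.

End FiniteTwist.

Theorem corollary3p3
  (p l n : nat)
  (F : finFieldType) (k : closedFieldType) (jk : {rmorphism F -> k})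
  (charF : p \in [pchar F]) (k_alg : forall x : k, algebraicOver jk x)
  (l_prime : prime l) (l_neq_p : l != p)
  (Ks : fieldType) (iota : {rmorphism laurent k -> Ks})
  (Ks_sep : is_separable_closure iota)
  (R : realType) (Ql : fieldType) (absQl : Ql -> R)
  (Ql_padic : is_padic_field l absQl)
  (Qlbar : closedFieldType) (j : {rmorphism Ql -> Qlbar})
  (absQlbar : Qlbar -> R)
  (Qlbar_closure : is_valued_closure absQl j absQlbar)
  (V : vectType Qlbar) (dimV : \dim {:V} = n)
  (rho : galgrp iota -> 'End(V))
  (rho_rep : is_representation rho)
  (rho_cont : continuous_rep absQlbar rho)
  (rho_irr : irreducible rho) :
  exists chi : galgrp iota -> Qlbar,
    [/\ is_character chi,
        continuous_char absQlbar chi,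
        (forall s, wild_inertia p s -> chi s = 1) &
        finite_set (range (twist rho chi))].
Proof.
have char_k : p \in [pchar k] by rewrite (fmorph_pchar jk).
have bp : absQlbar p%:R = 1.
  apply: (padic_abs_prime Ql_padic Qlbar_closure) => //.
  exact: pcharf_prime charF.
have [chi [chiM chi_cont chiK fin]] := exists_finite_twist Ks_sep char_k
  (closure_abs Qlbar_closure) bp rho_rep rho_cont rho_irr.
exists chi; split=> // s sW; apply: chiK.
exact: (wild_inertia_sub_kummer_fixer Ks_sep).
Qed.
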